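(* Let $N\ge 2$. For every probability density $F$ on $S^{N-1}$ (with respect to $\mu$), with $f_j$ the $j$-th marginal of $F$ for $j=1,\dots,N$, $$\sum_{j=1}^N S(f_j)\;\le\; 2\,S(F),$$ and the constant $2$ on the right side is the best possible.
   Context: $S^{N-1}$ is the unit sphere in $\mathbb{R}^N$ and $\mu$ is the uniform Borel probability measure on it. A probability density on $S^{N-1}$ is a non-negative measurable $F$ with $\int F\,d\mu=1$. The $j$-th marginal $f_j$ of $F$ is the conditional expectation of $F$ given the $j$-th coordinate $v_j$: it is the function on $[-1,1]$ (unique up to null sets of the law of $v_j$ under $\mu$) such that for all bounded measurable $\phi$ on $[-1,1]$, $$\int_{S^{N-1}}\phi(v_j)F(\vec v)\,d\mu=\int_{S^{N-1}}\phi(v_j)f_j(v_j)\,d\mu .$$ The entropies are $S(F)=\int_{S^{N-1}}F\ln F\,d\mu\in[0,\infty]$ and $S(f_j)=\int_{S^{N-1}}f_j(v_j)\ln f_j(v_j)\,d\mu$, with $0\ln 0=0$. *)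

(* Defs.v *)
From HB Require Import structures.
From mathcomp Require Import all_boot all_order all_algebra.
From mathcomp Require Import all_classical all_reals all_analysis.

Set Implicit Arguments.
Unset Strict Implicit.
Unset Printing Implicit Defensive.
Import Order.TTheory GRing.Theory Num.Theory.
Import numFieldNormedType.Exports.
Local Open Scope classical_set_scope.
Local Open Scope ring_scope.

(* Points of R^N are N-tuples: the sigma-algebra of the library on N.-tuple R is
   generated by the coordinates, hence is the Borel sigma-algebra of R^N. *)
Definition sphere (R : realType) (N : nat) : set (N.-tuple R) :=
  [set v | \sum_(i < N) tnth v i ^+ 2 = 1].

Definition mxact (R : realType) (N : nat) (O : 'M[R]_N) (v : N.-tuple R) :
    N.-tuple R :=
  [tuple \sum_(j < N) O i j * tnth v j | i < N].

(* A Borel probability measure on the sphere is represented by one on R^N that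
   is carried by the sphere. Invariance under all orthogonal maps characterizes
   the uniform one: it is the normalized surface measure. *)
Definition uniform_on_sphere (R : realType) (N : nat)
    (mu : probability (N.-tuple R) R) : Prop :=
  mu (@sphere R N) = 1%E /\
  forall O : 'M[R]_N, O *m O^T = 1%:M ->
  forall A : set (N.-tuple R), measurable A -> mu (mxact O @^-1` A) = mu A.

Section Entropy.
Variables (R : realType) (N : nat) (mu : probability (N.-tuple R) R).

Definition prob_density (F : N.-tuple R -> R) : Prop :=
  [/\ measurable_fun (@sphere R N) F,
      forall v, @sphere R N v -> 0 <= F v &
      (\int[mu]_(v in @sphere R N) (F v)%:E = 1)%E].

(* f is a version of the conditional expectation of F given the j-th
   coordinate; only its values on [-1, 1] matter. *)
Definition marginal (F : N.-tuple R -> R) (j : 'I_N) (f : R -> R) : Prop :=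
  [/\ measurable_fun `[(-1 : R), 1] f,
      mu.-integrable (@sphere R N) (fun v => (f (tnth v j))%:E) &
      forall phi : R -> R,
        measurable_fun `[(-1 : R), 1] phi ->
        (exists M : R, forall t : R, -1 <= t <= 1 -> `|phi t| <= M) ->
        (\int[mu]_(v in @sphere R N) (phi (tnth v j) * F v)%:E =
         \int[mu]_(v in @sphere R N) (phi (tnth v j) * f (tnth v j))%:E)%E].

(* The integrand is bounded below, so for a density this is a well-defined
   element of [0, +oo]. *)
Definition entropy (G : N.-tuple R -> R) : \bar R :=
  (\int[mu]_(v in @sphere R N) (G v * ln (G v))%:E)%E.

Definition entropy_bound (C : R) : Prop :=
  forall (F : N.-tuple R -> R) (f : 'I_N -> R -> R),
    prob_density F -> (forall j, marginal F j (f j)) ->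
    (\sum_(j < N) entropy (fun v => f j (tnth v j)) <= C%:E * entropy F)%E.

End Entropy.

(* Main.v *)
Require Import Defs.
From HB Require Import structures.
From mathcomp Require Import all_boot all_order all_algebra.
From mathcomp Require Import all_classical all_reals all_analysis.
From mathcomp Require Import measurable_realfun.
From mathcomp Require Import ring lra zify.
Import Order.TTheory GRing.Theory Num.Theory.
Import numFieldNormedType.Exports.

(** By duality (the Gibbs inequality), the bound follows from the Young-type
    inequality [E (prod_k g_k(v_k)) <= prod_k (E g_k(v_k)^2)^(1/2)] on the sphere,
    applied to [g_k] proportional to the square roots of the truncated marginals.
    That inequality is proved by letting each [u_k = g_k^2] evolve under the heat flow
    of the sphere, under which [E (prod_k sqrt u_k)] increases while every [u_k] tends
    to its mean. A rotation in the [(k, i)] plane moves only the two factors [u_k] and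
    [u_i], which is where the constant 2 comes from: AM-GM for two numbers, applied to
    [E G = E (G o rot)], gives the monotonicity without any integration by parts. For
    polynomial [u_k] the flow is replaced by its implicit Euler scheme, which stays
    within polynomials and obeys a minimum principle; the error vanishes with the time
    step.

    For sharpness take [F] proportional to [v_0^(2n)]. Its other marginals are
    proportional to [(1 - t^2)^n], so that [S(f_0) = S(F) ~ (N - 1) / 2 * ln n] while
    [S(f_j) ~ ln n / 2] for each of the [N - 1] other coordinates. *)

Set Implicit Arguments.
Unset Strict Implicit.
Unset Printing Implicit Defensive.
Local Open Scope classical_set_scope.
Local Open Scope ring_scope.

(** * Second variation of a polynomial along a rotation *)

Section Polynomials.
Variable R : realType.
Implicit Types (u p : {poly R}) (x y c s : R).

(** The measure is given only through its invariance under orthogonal maps, so there is no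
    parametrization to integrate against. Every integral identity, including the moment recursions
    behind the test densities, is extracted from plane rotations: averaging the rotations with sines
    s and -s cancels the first-order term, dividing by 1 - c leaves a second derivative, and
    invariance controls its mean. The exponent 1/2 does double duty. It gives the two moving factors
    AM-GM weights with sum 1, and it makes the logarithm of each factor half the logarithm of a
    marginal, which is how the Gibbs inequality returns the factor 2. Marginals are tested against
    bounded functions only, so [ln f_j] itself is not admissible. Truncation from above and below
    repairs this: the floor adds mass at most 1/c, and the ceiling is removed by monotone
    convergence. *)

Lemma horner_bounded p (b : R) :
  exists2 M, 0 <= M & forall x, `|x| <= b -> `|p.[x]| <= M.
Proof.
elim/poly_ind: p => [|p a [M M0 pM]].
  by exists 0 => // x _; rewrite horner0 normr0.
exists (M * `|b| + `|a|); first by rewrite addr_ge0 ?mulr_ge0.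
move=> x xb; rewrite hornerD hornerM hornerX hornerC.
apply: le_trans (ler_normD _ _) _; rewrite lerD2r normrM.
by apply: ler_pM => //; [exact: pM|apply: le_trans xb (ler_norm _)].
Qed.

(** Passing from [u] to [u * 'X + a] turns the remainder T into (x + h) T + u''(x) h^3 / 2, so
    induction on the polynomial gives the bound without a mean value theorem. The range |h| <= 2
    covers every displacement of a coordinate by a rotation. *)
Lemma taylor2 u : exists2 K, 0 <= K & forall x h, `|x| <= 1 -> `|h| <= 2 ->
  `|u.[x + h] - (u.[x] + u^`().[x] * h + u^`()^`().[x] / 2 * h ^+ 2)|
    <= K * `|h| ^+ 3.
Proof.
elim/poly_ind: u => [|u a [K K0 uK]].
  by exists 0 => // x h _ _; rewrite !(deriv0, horner0); rewrite !mul0r !addr0 subrr normr0.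
have [M M0 uM] := horner_bounded u^`()^`() 1.
exists (3 * K + M); first by rewrite addr_ge0 ?mulr_ge0.
move=> x h x1 h2.
rewrite !(derivD, derivM, derivX, derivC, hornerD, hornerM, hornerX, hornerC).
have := uK x h x1 h2.
set T := (X in `|X| <= _ -> _) => T3.
rewrite [X in `|X|](_ : _ = (x + h) * T + u^`()^`().[x] / 2 * h ^+ 3); last first.
  by rewrite /T; field.
apply: le_trans (ler_normD _ _) _.
rewrite [leRHS]mulrDl; apply: lerD.
  rewrite normrM -mulrA ler_pM//.
  by apply: le_trans (ler_normD _ _) _; lra.
rewrite normrM normrX ler_wpM2r ?exprn_ge0// normrM.
have := uM x x1; rewrite [`|2^-1|]ger0_norm ?invr_ge0//.
have := normr_ge0 u^`()^`().[x]; lra.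
Qed.

(* The second derivative of [u] along the rotation moving [x] to
   [c * x + s * y]; for [x = v_k], [y = v_i] this is (v_i d_k - v_k d_i)^2 u. *)
Definition rotd2 u x y := y ^+ 2 * u^`()^`().[x] - x * u^`().[x].

(** The natural unit is 1 - c, of order s^2: the first-order term in s cancels between the two
    rotations, and the error keeps a spare factor s after division by 1 - c. *)
Lemma rotation_expansion u : exists2 K, 0 <= K &
  forall x y c s, `|x| <= 1 -> `|y| <= 1 -> 0 <= c -> 0 <= s -> c ^+ 2 + s ^+ 2 = 1 ->
  `|(u.[c * x + s * y] + u.[c * x - s * y]) / 2 - u.[x]
    - (1 - c) * rotd2 u x y| <= K * (1 - c) * s.
Proof.
have [K K0 uK] := taylor2 u; have [M M0 uM] := horner_bounded u^`()^`() 1.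
exists (16 * K + M); first by rewrite addr_ge0 ?mulr_ge0.
move=> x y c s x1 y1 c0 s0 cs.
have c1 : c <= 1 by nra.
have s1 : s <= 1 by nra.
set d := 1 - c; have d0 : 0 <= d by rewrite /d; lra.
have ds : d <= s by rewrite /d; nra.
have s2 : s ^+ 2 <= 2 * d by rewrite /d; nra.
have ss : s ^+ 2 = 2 * d - d ^+ 2 by rewrite /d; nra.
have bnd (e : R) : `|e| = s -> `|- d * x + e * y| <= 2 * s.
  move=> es; apply: le_trans (ler_normD _ _) _.
  rewrite !normrM normrN es (ger0_norm d0).
  have := normr_ge0 x; have := normr_ge0 y; nra.
have cub (e : R) : `|e| <= 2 * s -> `|e| ^+ 3 <= 16 * d * s.
  move=> es; apply: (@le_trans _ _ ((2 * s) ^+ 3)).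
    by rewrite lerXn2r// ?nnegrE ?mulr_ge0.
  have -> : (2 * s) ^+ 3 = 8 * (s * s ^+ 2) by ring.
  have -> : 16 * d * s = 8 * (s * (2 * d)) by ring.
  by rewrite ler_pM2l// ler_wpM2l.
have hp := bnd s (ger0_norm s0).
have hm := bnd (- s) ltac:(by rewrite normrN ger0_norm).
have s22 : 2 * s <= 2 by lra.
have tp := uK x _ x1 (le_trans hp s22).
have tm := uK x _ x1 (le_trans hm s22).
have tp' := le_trans tp (ler_wpM2l K0 (cub _ hp)).
have tm' := le_trans tm (ler_wpM2l K0 (cub _ hm)).
have -> : c * x + s * y = x + (- d * x + s * y) by rewrite /d; ring.
have -> : c * x - s * y = x + (- d * x + - s * y) by rewrite /d; ring.
rewrite /rotd2.
move: tp' tm'; set Tp := (X in `|X| <= _ -> _); set Tm := (X in _ -> `|X| <= _ -> _).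
move=> tp' tm'.
(* Besides the Taylor remainders, substituting s^2 = 2d - d^2 in the quadratic term leaves one
   contribution of order d^2, absorbed through d <= s. *)
rewrite [X in `|X|](_ : _ = (Tp + Tm) / 2
   + d ^+ 2 * ((x ^+ 2 - y ^+ 2) / 2) * u^`()^`().[x]); last first.
  rewrite /Tp /Tm.
  have -> : (- d * x + - s * y) ^+ 2 = d ^+ 2 * x ^+ 2 + 2 * d * s * x * y
      + (2 * d - d ^+ 2) * y ^+ 2 by rewrite -ss; ring.
  have -> : (- d * x + s * y) ^+ 2 = d ^+ 2 * x ^+ 2 - 2 * d * s * x * y
      + (2 * d - d ^+ 2) * y ^+ 2 by rewrite -ss; ring.
  by field.
apply: le_trans (ler_normD _ _) _.
have -> : (16 * K + M) * d * s = K * (16 * d * s) + d * s * M by ring.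
apply: lerD.
  rewrite normrM [`|2^-1|]ger0_norm ?invr_ge0//.
  by have := ler_normD Tp Tm; lra.
rewrite !normrM; apply: ler_pM => //; last exact: uM.
rewrite [`|2^-1|]ger0_norm ?invr_ge0// (ger0_norm d0) -!mulrA.
apply: ler_wpM2l => //.
have : `|x ^+ 2 - y ^+ 2| <= 1.
  by move: x1 y1; rewrite !ler_norml; nra.
have := normr_ge0 (x ^+ 2 - y ^+ 2); nra.
Qed.

End Polynomials.

(** * The heat flow on polynomials of one coordinate *)

Section PolynomialFlow.
Variable R : realType.
Implicit Types (u p : {poly R}) (x y c s : R).

Lemma le0_of_small (a K : R) : 0 <= K ->
  (forall s, 0 < s -> s <= 1 -> a <= K * s) -> a <= 0.
Proof.
move=> K0 aK; rewrite leNgt; apply/negP => a0.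
have d0 : 0 < a + K + 1 by lra.
have := aK (a / (a + K + 1)) (divr_gt0 a0 d0).
rewrite ler_pdivrMr// mul1r mulrA ler_pdivlMr// => /(_ ltac:(lra)); nra.
Qed.

Lemma bernoulli_ineq (x : R) n : -1 <= x -> 1 + n%:R * x <= (1 + x) ^+ n.
Proof.
move=> x1; elim: n => [|n IH]; first by rewrite mul0r addr0 expr0.
rewrite exprS; apply: (@le_trans _ _ ((1 + x) * (1 + n%:R * x))).
  rewrite -natr1; have : (0 : R) <= n%:R by []; nra.
by rewrite ler_wpM2l//; lra.
Qed.

Variable N : nat.

(** The Gegenbauer operator: the Laplace-Beltrami operator of the sphere acting on functions of a
    single coordinate. *)
Definition laplace u : {poly R} :=
  (1 - 'X^2) * u^`()^`() - N.-1%:R *: ('X * u^`()).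

Lemma laplace_linear : linear laplace.
Proof.
move=> a p u; rewrite /laplace !(derivD, derivZ) !mulrDr !scalerDr -!scalerAr.
by rewrite scalerN opprD !scalerA [a * _]mulrC addrACA.
Qed.
HB.instance Definition _ :=
  GRing.isLinear.Build R {poly R} {poly R} _ laplace laplace_linear.

Lemma laplaceZ a u : laplace (a *: u) = a *: laplace u.
Proof. exact: linearZ. Qed.

Lemma horner_laplace u x : (laplace u).[x] =
  (1 - x ^+ 2) * u^`()^`().[x] - N.-1%:R * (x * u^`().[x]).
Proof. by rewrite /laplace !hornerE. Qed.

Hypothesis N2 : (2 <= N)%N.

(** The operator degenerates at the end points, where a minimum need not be critical. Viewing [x] as
    a coordinate of a point (x, y) of the unit disk avoids a case distinction: rotating the point
    keeps its first coordinate in [-1, 1], so no rotation can lower [u]. *)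
Lemma laplace_ge0_at_min u x : `|x| <= 1 ->
  (forall t, `|t| <= 1 -> u.[x] <= u.[t]) -> 0 <= (laplace u).[x].
Proof.
move=> x1 xmin.
have [K K0 uK] := rotation_expansion u.
have rot y : x ^+ 2 + y ^+ 2 <= 1 -> 0 <= rotd2 u x y.
  move=> xy; rewrite -oppr_le0; apply: (@le0_of_small _ K) => // s s0 s1.
  set c := Num.sqrt (1 - s ^+ 2).
  have c0 : 0 <= c by apply: sqrtr_ge0.
  have cs : c ^+ 2 + s ^+ 2 = 1 by rewrite sqr_sqrtr; [ring|nra].
  have y1 : `|y| <= 1 by rewrite ler_norml; nra.
  have := uK x y c s x1 y1 c0 (ltW s0) cs.
  have cx (e : R) : e ^+ 2 = s ^+ 2 -> u.[x] <= u.[c * x + e * y].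
    move=> es; apply: xmin.
    have : (c * x + e * y) ^+ 2 <= 1.
      have := sqr_ge0 (c * y - e * x).
      have -> : (c * y - e * x) ^+ 2 =
        (c ^+ 2 + e ^+ 2) * (x ^+ 2 + y ^+ 2) - (c * x + e * y) ^+ 2 by ring.
      by rewrite es cs; lra.
    by rewrite ler_norml; nra.
  have := cx s erefl; have := cx (- s) (sqrrN s); rewrite mulNr.
  rewrite ler_norml => um up /andP[_ ul].
  have c1 : 0 < 1 - c by nra.
  by rewrite -(ler_pM2l c1); lra.
have x21 : x ^+ 2 <= 1 by move: x1; rewrite ler_norml; nra.
(* The Laplacian is the term for y^2 = 1 - x^2 plus N - 2 times the term for y = 0. *)
have h1 := rot (Num.sqrt (1 - x ^+ 2)).
have h2 := rot 0.
move: h1 h2; rewrite /rotd2 sqr_sqrtr ?subr_ge0// expr0n/= addr0 horner_laplace.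
have -> : N.-1%:R = 1 + (N - 2)%:R :> R by rewrite nat1r; congr (_%:R); lia.
move=> h1 h2; have {}h2 := h2 x21; have {}h1 := h1 ltac:(lra).
have : (0 : R) <= (N - 2)%:R by [].
nra.
Qed.

(** At a point of [-1, 1] where [u] is least the Laplacian is nonnegative, so [u] dominates
    [u - e *: laplace u] there. *)
Lemma resolvent_ge u (e b : R) : 0 <= e ->
  (forall x, `|x| <= 1 -> b <= (u - e *: laplace u).[x]) ->
  forall x, `|x| <= 1 -> b <= u.[x].
Proof.
move=> e0 ub x x1.
have [t + tmin] := @EVT_min R (horner u) (-1) 1 ltac:(lra)
  (continuous_subspaceT (@continuous_horner R u)).
rewrite in_itv/= -ler_norml => t1.
have tmin' z : `|z| <= 1 -> u.[t] <= u.[z].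
  by move=> z1; apply: tmin; rewrite in_itv/= -ler_norml.
have := laplace_ge0_at_min t1 tmin'; have := ub t t1.
have := tmin' x x1; rewrite hornerD hornerN hornerZ; nra.
Qed.

Let lam m : R := (m * (m + N - 2))%:R.

Lemma laplaceXSS n : laplace 'X^(n.+2) =
  (n.+2 * n.+1)%:R *: 'X^n - (n.+2 * (n + N))%:R *: 'X^(n.+2).
Proof.
rewrite /laplace derivXn derivMn derivXn /=.
have -> : 'X^n *+ n.+1 *+ n.+2 = (n.+2 * n.+1)%:R *: 'X^n :> {poly R}.
  by rewrite scaler_nat -mulrnA mulnC.
have -> : 'X^(n.+1) *+ n.+2 = n.+2%:R *: 'X^(n.+1) :> {poly R} by rewrite scaler_nat.
rewrite -!scalerAr mulrBl mul1r -exprD -exprS scalerA scalerBr -addrA -opprD.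
rewrite -scalerDl add2n -natrM -natrD.
by congr (_ - _%:R *: _); nia.
Qed.

Lemma laplaceXn n : exists2 r : {poly R}, (size r <= n)%N &
  laplace 'X^n = r - lam n *: 'X^n.
Proof.
case: n => [|[|n]].
- exists 0; first by rewrite size_poly0.
  by rewrite /laplace /lam expr0 -polyC1 derivC deriv0 !mulr0 scaler0 mul0n scale0r.
- exists 0; first by rewrite size_poly0.
  rewrite /laplace /lam expr1 derivX -polyC1 derivC mulr0 mulr1 !sub0r mul1n.
  by congr (- (_%:R *: _)); lia.
exists ((n.+2 * n.+1)%:R *: 'X^n).
  by apply: leq_trans (size_scale_leq _ _) _; rewrite size_polyXn.
rewrite laplaceXSS /lam; congr (_ - (_ * _)%:R *: _); lia.
Qed.

Lemma lam_lt m n : (m < n)%N -> lam m < lam n.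
Proof. by move=> mn; rewrite ltr_nat; nia. Qed.

(** The operator is triangular on monomials with strictly increasing eigenvalue parameters [lam],
    hence diagonalizable. The components [q m] may vanish. *)
Lemma laplace_eigen n p : (size p <= n)%N -> exists q : nat -> {poly R},
  (forall m, (size (q m) <= m.+1)%N /\ laplace (q m) = - lam m *: q m)
  /\ p = \sum_(m < n) q m.
Proof.
elim: n p => [|n IH] p pn.
  exists (fun=> 0); split; last by rewrite big_ord0; apply/eqP; rewrite -size_poly_leq0.
  by move=> m; rewrite size_poly0 linear0 scaler0.
have [r rn Lr] := laplaceXn n.
have [q [qE rq]] := IH r rn.
(* The monic eigenpolynomial of degree n: the correction solves the eigenvalue equation component by
   component in the decomposition of [r]. *)
pose C := 'X^n - \sum_(m < n) (lam n - lam m)^-1 *: q m.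
have LC : laplace C = - lam n *: C.
  rewrite /C linearB linear_sum/= Lr rq scalerBr scaler_sumr scaleNr addrAC.
  rewrite -sumrB addrC; congr (_ + _); rewrite -sumrN; apply: eq_bigr => m _.
  rewrite laplaceZ (qE m).2 !scalerA -[X in X - _]scale1r -scalerBl -[RHS]scaleNr.
  congr (_ *: _); have := lam_lt (ltn_ord m); rewrite -subr_gt0 => l0.
  move: (lam n) (lam m) l0 => a b /lt0r_neq0 l0.
  rewrite mulrN opprK mulNr opprK -[X in X + _](divff l0) [_^-1 * _]mulrC -mulrDl.
  by rewrite subrK.
have sC : (size C <= n.+1)%N.
  apply/leq_sizeP => j nj; rewrite coefB coefXn gtn_eqF// coef_sum big1 ?subr0// => m _.
  by rewrite coefZ (leq_sizeP _ _ (qE m).1) ?mulr0// ltnW// (leq_trans _ nj)// ltnS.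
pose a : R := p`_n.
have sp : (size (p - a *: C)%R <= n)%N.
  apply/leq_sizeP => j; rewrite leq_eqVlt => /predU1P[<-|nj].
    rewrite coefB coefZ /C /a coefB coefXn eqxx coef_sum big1 ?subr0 ?mulr1 ?subrr// => m _.
    by rewrite coefZ (leq_sizeP _ _ (qE m).1) ?mulr0.
  by rewrite coefB coefZ (leq_sizeP _ _ pn)// (leq_sizeP _ _ sC)// mulr0 subr0.
have [q' [q'E pq']] := IH _ sp.
exists (fun m => if m == n then a *: C else q' m); split.
  move=> m; case: eqP => [->|_]; last exact: q'E.
  split; first exact: leq_trans (size_scale_leq _ _) sC.
  by rewrite laplaceZ LC !scalerA mulrC.
rewrite big_ord_recr/= eqxx; apply/eqP; rewrite -subr_eq pq'; apply/eqP.
by apply: eq_bigr => m _; rewrite ltn_eqF.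
Qed.

(* Implicit Euler scheme for the heat flow: unlike the flow itself it preserves
   polynomials and lower bounds by purely algebraic means. *)
Lemma implicit_euler p : exists m0 A, 0 <= A /\ forall e : R, 0 < e ->
  exists U : nat -> {poly R},
  [/\ U 0%N = p,
      forall r, U r.+1 - e *: laplace (U r.+1) = U r,
      forall r x, `|x| <= 1 -> `|(laplace (U r)).[x]| <= A &
      forall r x, `|x| <= 1 -> `|(U r).[x] - m0| <= A / (1 + r%:R * e)].
Proof.
have [q [qE pq]] := laplace_eigen (leqnSn (size p)).
set n := size p in pq.
have [M qM] : exists M : nat -> R, forall m, 0 <= M m /\
    forall x, `|x| <= 1 -> `|(q m).[x]| <= M m.
  have /choice[M HM] : forall m, exists M : R, 0 <= M /\
      forall x, `|x| <= 1 -> `|(q m).[x]| <= M.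
    by move=> m; have [M ? ?] := horner_bounded (q m) 1; exists M.
  by exists M.
have lam0 m : 0 <= lam m by [].
(* The constant component is the limit. The weights [1 + lam m] let one constant bound both the
   Laplacian and the distance to the limit. *)
exists (q 0%N).[0], (\sum_(m < n.+1) (1 + lam m) * M m); split.
  by apply: sumr_ge0 => m _; rewrite mulr_ge0 ?addr_ge0// (qM _).1.
move=> e e0; have el m : 0 < 1 + e * lam m.
  by rewrite ltr_pwDl// mulr_ge0// ltW.
exists (fun r => \sum_(m < n.+1) (1 + e * lam m) ^- r *: q m); split.
- by rewrite pq; apply: eq_bigr => m _; rewrite expr0 invr1 scale1r.
- move=> r; rewrite linear_sum/= scaler_sumr -sumrB; apply: eq_bigr => m _.
  rewrite laplaceZ (qE m).2 !scalerA -scalerBl; congr (_ *: _).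
  move: (el m); rewrite mulrN opprK mulrAC; move: (e * lam m) => l l0.
  rewrite -[X in X + _]mul1r -mulrDl exprS invfM mulVKf ?gt_eqF//.
- move=> r x x1; rewrite linear_sum/= horner_sum; apply: le_trans (ler_norm_sum _ _ _) _.
  apply: ler_sum => m _; rewrite laplaceZ (qE m).2 scalerA hornerZ normrM.
  apply: ler_pM => //; last exact: (qM m).2.
  rewrite mulrN normrN normrM !ger0_norm ?lam0 ?invr_ge0 ?exprn_ge0 ?(ltW (el m))//.
  apply: (@le_trans _ _ (lam m)); last by have := lam0 m; lra.
  rewrite ler_piMl// invf_le1 ?exprn_gt0// exprn_ege1// lerDl mulr_ge0// ltW//.
- move=> r x x1.
  have re0 : 0 < 1 + r%:R * e by rewrite ltr_pwDl// mulr_ge0// ltW.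
  rewrite !horner_sum big_ord_recl/=.
  have -> : lam 0%N = 0 by rewrite /lam mul0n.
  have -> : (1 + e * 0) ^- r *: q 0%N = q 0%N.
    by rewrite mulr0 addr0 expr1n invr1 scale1r.
  have := size1_polyC (qE 0%N).1 => q0; rewrite {1}q0 [in X in _ - X]q0 !hornerC addrC addKr.
  apply: le_trans (ler_norm_sum _ _ _) _.
  rewrite big_ord_recl mulrDl; apply: ler_wpDl.
    by rewrite !(mulr_ge0, addr_ge0, invr_ge0)// ?(qM _).1// ltW.
  rewrite mulr_suml; apply: ler_sum => m _; rewrite hornerZ normrM.
  rewrite [leRHS]mulrAC; apply: ler_pM => //; last exact: (qM _).2.
  (* This spectral gap and the Bernoulli inequality give a decay depending only on the elapsed time
     [r%:R * e]. *)
  have l1 : 1 <= lam (lift ord0 m) by rewrite ler1n lift0 muln_gt0; lia.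
  rewrite ger0_norm ?invr_ge0 ?exprn_ge0 ?(ltW (el _))//.
  apply: (@le_trans _ _ (1 + r%:R * e)^-1).
    rewrite lef_pV2 ?posrE ?exprn_gt0//.
    apply: le_trans (bernoulli_ineq r _); last by have := el (lift ord0 m); lra.
    rewrite lerD2l ler_wpM2l// ler_peMr// ltW//.
  by rewrite ler_peMl ?invr_ge0 ?(ltW re0)//; lra.
Qed.

End PolynomialFlow.

(** * Means over the sphere and rotation invariance *)

Section SphereMean.
Variables (R : realType) (N : nat) (mu : probability (N.-tuple R) R).
Hypothesis hmu : uniform_on_sphere mu.
Implicit Types (g f : N.-tuple R -> R) (v : N.-tuple R) (u p : {poly R}).
Local Notation D := (@sphere R N).

Lemma measurable_coord (i : 'I_N) A : measurable_fun A (fun v => tnth v i).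
Proof. by apply: measurable_funTS; exact: measurable_tnth. Qed.

Lemma measurable_sphere : measurable D.
Proof.
have m : measurable_fun [set: N.-tuple R] (fun v => \sum_(i < N) tnth v i ^+ 2).
  by apply: measurable_sum => i; apply: measurable_funX; exact: measurable_coord.
rewrite /sphere (_ : [set v | _] = setT `&`
    (fun v => \sum_(i < N) tnth v i ^+ 2) @^-1` [set 1]); last by rewrite setTI.
exact: m (measurable_set1 1).
Qed.
Hint Resolve measurable_sphere : core.

Lemma sphere_coord v i : D v -> `|tnth v i| <= 1.
Proof.
rewrite /sphere/= (bigD1 i)//= => v1.
have : 0 <= \sum_(j < N | j != i) tnth v j ^+ 2 by apply: sumr_ge0 => j _; exact: sqr_ge0.
by rewrite ler_norml; nra.
Qed.

Definition bm g := measurable_fun D g /\ exists M, forall v, D v -> `|g v| <= M.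

Lemma bm_cst (a : R) : bm (fun=> a).
Proof. by split; [exact: measurable_cst|exists `|a|]. Qed.

Lemma bmD f g : bm f -> bm g -> bm (fun v => f v + g v).
Proof.
move=> [mf [A fA]] [mg [B gB]]; split; first exact: measurable_funD.
by exists (A + B) => v Dv; apply: le_trans (ler_normD _ _) _; rewrite lerD ?fA ?gB.
Qed.

Lemma bmM f g : bm f -> bm g -> bm (fun v => f v * g v).
Proof.
move=> [mf [A fA]] [mg [B gB]]; split; first exact: measurable_funM.
by exists (A * B) => v Dv; rewrite normrM ler_pM ?fA ?gB.
Qed.

Lemma bmZ a f : bm f -> bm (fun v => a * f v).
Proof. by move=> bf; apply: bmM => //; exact: bm_cst. Qed.

Lemma bmN f : bm f -> bm (fun v => - f v).
Proof.
by move=> [mf [A fA]]; split; [exact: measurableT_comp|exists A => v /fA; rewrite normrN].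
Qed.

Lemma bmB f g : bm f -> bm g -> bm (fun v => f v - g v).
Proof. by move=> bf bg; apply: bmD => //; exact: bmN. Qed.

Lemma bmX f n : bm f -> bm (fun v => f v ^+ n).
Proof.
move=> bf; elim: n => [|n IH].
  by rewrite (_ : (fun v => _) = fun=> 1); [exact: bm_cst|apply/funext => v; rewrite expr0].
by rewrite (_ : (fun v => _) = fun v => f v * f v ^+ n); [exact: bmM|apply/funext => v; rewrite exprS].
Qed.

Lemma bm_sum (I : Type) (r : seq I) (P : pred I) (F : I -> N.-tuple R -> R) :
  (forall i, P i -> bm (F i)) -> bm (fun v => \sum_(i <- r | P i) F i v).
Proof.
move=> bF; elim: r => [|i r IH].
  by rewrite (_ : (fun v => _) = fun=> 0); [exact: bm_cst|apply/funext => v; rewrite big_nil].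
rewrite (_ : (fun v => _) = fun v => (if P i then F i v else 0) + \sum_(i <- r | P i) F i v).
  by apply: bmD => //; case Pi: (P i); [exact: bF|exact: bm_cst].
by apply/funext => v; rewrite big_cons; case: ifP; rewrite ?add0r.
Qed.

Lemma bm_prod (I : Type) (r : seq I) (P : pred I) (F : I -> N.-tuple R -> R) :
  (forall i, P i -> bm (F i)) -> bm (fun v => \prod_(i <- r | P i) F i v).
Proof.
move=> bF; elim: r => [|i r IH].
  by rewrite (_ : (fun v => _) = fun=> 1); [exact: bm_cst|apply/funext => v; rewrite big_nil].
rewrite (_ : (fun v => _) = fun v => (if P i then F i v else 1) * \prod_(i <- r | P i) F i v).
  by apply: bmM => //; case Pi: (P i); [exact: bF|exact: bm_cst].
by apply/funext => v; rewrite big_cons; case: ifP; rewrite ?mul1r.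
Qed.

Lemma bm_coord i : bm (fun v => tnth v i).
Proof. by split; [exact: measurable_coord|exists 1 => v; exact: sphere_coord]. Qed.

Lemma bm_horner u g : bm g -> bm (fun v => u.[g v]).
Proof.
move=> [mg [b gb]]; split.
  by apply: measurableT_comp => //; exact: measurable_poly.
have [M _ uM] := horner_bounded u b; exists M => v Dv.
by apply: uM; exact: gb.
Qed.

Lemma bm_poly u i : bm (fun v => u.[tnth v i]).
Proof. exact: bm_horner (bm_coord i). Qed.

Lemma bm_comp (h : R -> R) i : measurable_fun `[(-1 : R), 1] h ->
  (exists M, forall t, -1 <= t <= 1 -> `|h t| <= M) -> bm (fun v => h (tnth v i)).
Proof.
move=> mh [M hM]; split.
  apply: (@measurable_comp _ _ _ _ _ _ `[(-1 : R), 1]) => //; last exact: measurable_coord.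
  by move=> _ [v /(@sphere_coord _ i) vi <-]; rewrite /= in_itv/= -ler_norml.
by exists M => v /(@sphere_coord _ i) vi; apply: hM; rewrite -ler_norml.
Qed.

Lemma bm_sqrt f : bm f -> bm (fun v => Num.sqrt (f v)).
Proof.
move=> [mf [M fM]]; split.
  apply: measurableT_comp => //; apply: continuous_measurable_fun.
  exact: sqrt_continuous.
exists (Num.sqrt M) => v Dv; rewrite ger0_norm ?sqrtr_ge0//.
by apply: ler_wsqrtr; apply: le_trans (fM v Dv); exact: ler_norm.
Qed.

Lemma bm_inv f b : 0 < b -> (forall v, D v -> b <= f v) -> bm f ->
  bm (fun v => (f v)^-1).
Proof.
move=> b0 bf [mf _]; split.
  apply: (@eq_measurable_fun _ _ _ _ _ (fun v => f v `^ (- 1))).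
    by move=> v; rewrite inE => /bf fv; rewrite powR_inv1// (le_trans _ fv)// ltW.
  exact: (measurableT_comp (measurable_powR (- 1)) mf).
exists b^-1 => v Dv; have fv := bf v Dv; have f0 := lt_le_trans b0 fv.
by rewrite ger0_norm ?invr_ge0 ?(ltW f0)// lef_pV2.
Qed.

Lemma bm_integrable g : bm g -> mu.-integrable D (EFin \o g).
Proof.
move=> [mg [M gM]]; apply: measurable_bounded_integrable => //.
  by apply: (@le_lt_trans _ _ 1%E); [exact: probability_le1|exact: ltry].
exists M; split; first exact: num_real.
by move=> x Mx v Dv; apply: le_trans (gM v Dv) (ltW Mx).
Qed.

Definition mean g : R := \int[mu]_(v in D) g v.

Lemma EFin_mean g : bm g -> (mean g)%:E = (\int[mu]_(v in D) (g v)%:E)%E.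
Proof.
move=> bg; rewrite /mean /Rintegral fineK//.
exact: integrable_fin_num (bm_integrable bg).
Qed.

Lemma mean_cst (a : R) : mean (fun=> a) = a.
Proof.
rewrite /mean Rintegral_cst//; have [+ _] := hmu; rewrite /= => ->.
by rewrite mulr1.
Qed.

Lemma eq_mean f g : (forall v, D v -> f v = g v) -> mean f = mean g.
Proof. by move=> fg; apply: eq_Rintegral => v; rewrite inE => /fg. Qed.

Lemma meanD f g : bm f -> bm g -> mean (fun v => f v + g v) = mean f + mean g.
Proof. by move=> bf bg; rewrite /mean RintegralD//; exact: bm_integrable. Qed.

Lemma meanZ a f : bm f -> mean (fun v => a * f v) = a * mean f.
Proof. by move=> bf; rewrite /mean RintegralZl//; exact: bm_integrable. Qed.

Lemma meanN f : bm f -> mean (fun v => - f v) = - mean f.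
Proof.
move=> bf; rewrite -[RHS]mulN1r -meanZ//; apply: eq_mean => v _.
by rewrite mulN1r.
Qed.

Lemma meanB f g : bm f -> bm g -> mean (fun v => f v - g v) = mean f - mean g.
Proof. by move=> bf bg; rewrite meanD ?meanN//; exact: bmN. Qed.

Lemma mean_sum (I : Type) (r : seq I) (P : pred I) (F : I -> N.-tuple R -> R) :
  (forall i, P i -> bm (F i)) ->
  mean (fun v => \sum_(i <- r | P i) F i v) = \sum_(i <- r | P i) mean (F i).
Proof.
move=> bF; elim: r => [|i r IH].
  by rewrite big_nil -[RHS](mean_cst 0); apply: eq_mean => v _; rewrite big_nil.
rewrite big_cons -IH; case: ifPn => Pi; last first.
  by apply: eq_mean => v _; rewrite big_cons (negbTE Pi).
rewrite -meanD; [|exact: bF|exact: bm_sum].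
by apply: eq_mean => v _; rewrite big_cons Pi.
Qed.

Lemma le_mean f g : bm f -> bm g -> (forall v, D v -> f v <= g v) -> mean f <= mean g.
Proof. by move=> bf bg fg; apply: le_Rintegral => //; exact: bm_integrable. Qed.

Lemma mean_ge0 f : (forall v, D v -> 0 <= f v) -> 0 <= mean f.
Proof. by move=> f0; apply: Rintegral_ge0. Qed.

Section Rotation.
Variables (k i : 'I_N) (c s : R).
Hypotheses (ki : k != i) (cs : c ^+ 2 + s ^+ 2 = 1).

Definition rotmx : 'M[R]_N := \matrix_(a, b)
  if a == k then c * (b == k)%:R + s * (b == i)%:R
  else if a == i then c * (b == i)%:R - s * (b == k)%:R else (b == a)%:R.

Lemma sum_delta (f : 'I_N -> R) a : \sum_b (b == a)%:R * f b = f a.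
Proof.
rewrite (bigD1 a)//= eqxx mul1r big1 ?addr0// => b /negbTE ->.
by rewrite mul0r.
Qed.

Lemma rotmx_act (f : 'I_N -> R) a : \sum_b rotmx a b * f b =
  if a == k then c * f k + s * f i
  else if a == i then c * f i - s * f k else f a.
Proof.
under eq_bigr do rewrite mxE.
case: eqP => _; last case: eqP => _; last exact: sum_delta.
  under eq_bigr do rewrite mulrDl -!mulrA.
  by rewrite big_split -!mulr_sumr !sum_delta.
under eq_bigr do rewrite mulrBl -!mulrA.
by rewrite sumrB -!mulr_sumr !sum_delta.
Qed.

Lemma rotmx_orthogonal : rotmx *m rotmx^T = 1%:M.
Proof.
apply/matrixP => a b; rewrite !mxE; under eq_bigr do rewrite [_^T _ _]mxE.
rewrite rotmx_act !mxE.
have ik : (i == k) = false by rewrite eq_sym (negbTE ki).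
case: (eqVneq a k) => [->|ak]; last case: (eqVneq a i) => [->|ai].
- case: (eqVneq b k) => [|bk]; last case: (eqVneq b i) => [|bi].
  + by rewrite !eqxx ik (negbTE ki) => _; transitivity (c ^+ 2 + s ^+ 2); [rewrite /=; ring|].
  + by rewrite !eqxx ik (negbTE ki) => _ /=; ring.
  + by rewrite /=; ring.
- case: (eqVneq b k) => [|bk]; last case: (eqVneq b i) => [|bi].
  + by rewrite !eqxx ik (negbTE ki) => -> /=; rewrite ik /=; ring.
  + by rewrite !eqxx ik (negbTE ki) => _; transitivity (c ^+ 2 + s ^+ 2); [rewrite /=; ring|].
  + by rewrite /=; ring.
- case: (eqVneq b k) => [->|bk]; last case: (eqVneq b i) => [->|bi] //.
  + by rewrite (negbTE ak) /=; ring.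
  + by rewrite (negbTE ai) /=; ring.
Qed.

Lemma tnth_rot v a : tnth (mxact rotmx v) a =
  if a == k then c * tnth v k + s * tnth v i
  else if a == i then c * tnth v i - s * tnth v k else tnth v a.
Proof. by rewrite tnth_mktuple rotmx_act. Qed.

Lemma measurable_rot : measurable_fun setT (mxact rotmx).
Proof.
apply/measurable_fun_tnthP => a.
rewrite (_ : _ \o _ = fun v => \sum_(j < N) rotmx a j * tnth v j).
  by apply: measurable_sum => j; apply: measurable_funM => //; exact: measurable_coord.
by apply/funext => v /=; rewrite tnth_mktuple.
Qed.

Lemma sphere_rot : mxact rotmx @^-1` D = D.
Proof.
apply/funext => v; rewrite /sphere /preimage/=; congr (_ = _).
have ik : i != k by rewrite eq_sym.
rewrite (bigD1 k)//= (bigD1 i)//= [RHS](bigD1 k)//= [in RHS](bigD1 i)//=.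
rewrite !tnth_rot !eqxx (negbTE ik) !addrA.
congr (_ + _); last by apply: eq_bigr => j /andP[/negbTE jk /negbTE ji]; rewrite tnth_rot jk ji.
by rewrite -[RHS]mul1r -cs; ring.
Qed.

Lemma mean_rot g : bm g ->
  bm (fun v => g (mxact rotmx v)) /\ mean (fun v => g (mxact rotmx v)) = mean g.
Proof.
move=> bg; have [mg [M gM]] := bg.
have bgr : bm (fun v => g (mxact rotmx v)).
  split; last by exists M => v Dv; apply: gM; rewrite -sphere_rot in Dv.
  apply: (@measurable_comp _ _ _ _ _ _ D) => //.
    by move=> _ [v Dv <-]; rewrite -sphere_rot in Dv.
  by apply: measurable_funTS; exact: measurable_rot.
(* Adding the bound [M] makes both integrands nonnegative, so the pushforward formula for
   nonnegative functions applies. *)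
split => //; apply: (@addrI _ M).
rewrite -[X in X + _ = _](mean_cst M) -[X in _ = X + _](mean_cst M).
have bM := bm_cst M; rewrite -!meanD//; apply: EFin_inj; rewrite !EFin_mean//; try exact: bmD.
rewrite -[in LHS]sphere_rot.
rewrite -(@ge0_integral_pushforward _ _ _ _ _ _ measurable_rot mu D (fun v => (M + g v)%:E))//.
- apply: (@eq_measure_integral _ _ _ _ mu); first exact: measurable_rot.
  by move=> mrot A mA _; have [_ inv] := hmu; exact: (inv _ rotmx_orthogonal A mA).
- by apply/measurable_EFinP; exact: (bmD bM bg).1.
- move=> v; rewrite inE => Dv; rewrite lee_fin.
  by have := gM v Dv; rewrite ler_norml; lra.
Qed.

End Rotation.
End SphereMean.

(** * The Young-type inequality for polynomials *)

Section YoungPositive.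
Variables (R : realType) (N : nat) (mu : probability (N.-tuple R) R).
Hypotheses (hmu : uniform_on_sphere mu) (N2 : (2 <= N)%N).
Implicit Types (v : N.-tuple R) (p : {poly R}) (u w : 'I_N -> {poly R}).
Local Notation D := (@sphere R N).
Local Notation E := (mean mu).

Lemma bm_rotd2 p k i : bm (fun v => rotd2 p (tnth v k) (tnth v i)).
Proof.
apply: bmB; apply: bmM; try exact: bm_poly; first exact/bmX/bm_coord.
exact: bm_coord.
Qed.

(** Divide by 1 - c and let s tend to 0. The error in [rotation_expansion] is uniform on the sphere,
    so nothing is differentiated under the integral. *)
Lemma second_variation p q (A B : N.-tuple R -> R) k i : bm A -> bm B ->
  (forall c s, 0 <= c -> 0 < s -> c ^+ 2 + s ^+ 2 = 1 ->
    0 <= E (fun v =>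
      A v * ((p.[c * tnth v k + s * tnth v i] + p.[c * tnth v k - s * tnth v i]) / 2
             - p.[tnth v k])
    + B v * ((q.[c * tnth v i + s * tnth v k] + q.[c * tnth v i - s * tnth v k]) / 2
             - q.[tnth v i]))) ->
  0 <= E (fun v => A v * rotd2 p (tnth v k) (tnth v i)
                 + B v * rotd2 q (tnth v i) (tnth v k)).
Proof.
move=> bA bB var.
have [K1 K10 pK] := rotation_expansion p; have [K2 K20 qK] := rotation_expansion q.
have [_ [MA AM]] := bA; have [_ [MB BM]] := bB.
rewrite -oppr_le0; apply: (@le0_of_small _ _ (`|MA| * K1 + `|MB| * K2)).
  by rewrite addr_ge0 ?mulr_ge0.
move=> s s0 s1; set c := Num.sqrt (1 - s ^+ 2).
have c0 : 0 <= c by apply: sqrtr_ge0.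
have cs : c ^+ 2 + s ^+ 2 = 1 by rewrite sqr_sqrtr; [ring|nra].
have c1 : 0 < 1 - c by nra.
set S := (X in E X) ; set K := _ + _.
have bS : bm S by apply: bmD; apply: bmM => //; exact: bm_rotd2.
rewrite -(ler_pM2l c1) mulrN -subr_ge0 opprK -meanZ//.
rewrite -(mean_cst hmu ((1 - c) * (K * s))) -meanD//; try exact: bmZ; try exact: bm_cst.
apply: le_trans (var c s c0 s0 cs) _; apply: le_mean => //.
- apply: bmD; (apply: bmM => //; apply: bmB; last exact: bm_poly); apply: bmM;
    try exact: bm_cst; apply: bmD; apply: bm_horner;
    first [apply: bmB|apply: bmD]; apply: bmZ; exact: bm_coord.
- by apply: bmD; [exact: bm_cst|exact: bmZ].
move=> v Dv.
have vk := sphere_coord k Dv; have vi := sphere_coord i Dv.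
have := pK _ _ c s vk vi c0 (ltW s0) cs; have := qK _ _ c s vi vk c0 (ltW s0) cs.
rewrite /S; move: (rotd2 _ _ _) (rotd2 _ _ _) => dq dp.
set X := (q.[_] + _) / 2 - _; set Y := (p.[_] + _) / 2 - _ => HX HY.
have aux (a M x K' t : R) : `|a| <= M -> `|x| <= t -> a * x <= `|M| * t.
  move=> aM xt; apply: le_trans (ler_norm _) _; rewrite normrM ler_pM//.
  by apply: le_trans aM (ler_norm _).
have h1 := aux _ _ _ K1 _ (AM v Dv) HY; have h2 := aux _ _ _ K1 _ (BM v Dv) HX.
rewrite /K; nra.
Qed.

(** This takes the place of integration by parts. By invariance the finite differences weighted by
    [W] have mean zero, so [second_variation] applies to both [W] and [- W]. *)
Lemma mean_rotd2 (W : N.-tuple R -> R) p k i : k != i -> bm W ->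
  (forall c s v, c ^+ 2 + s ^+ 2 = 1 -> D v -> W (mxact (rotmx k i c s) v) = W v) ->
  E (fun v => W v * rotd2 p (tnth v k) (tnth v i)) = 0.
Proof.
move=> ki bW Winv.
have ge0 (V : N.-tuple R -> R) : bm V ->
  (forall c s v, c ^+ 2 + s ^+ 2 = 1 -> D v -> V (mxact (rotmx k i c s) v) = V v) ->
  0 <= E (fun v => V v * rotd2 p (tnth v k) (tnth v i)).
  move=> bV Vinv.
  have := @second_variation p 0 V (fun=> 0) k i bV (bm_cst N 0).
  rewrite (@eq_mean _ _ mu _ (fun v => V v * rotd2 p (tnth v k) (tnth v i))); last first.
    by move=> v _; rewrite mul0r addr0.
  apply => c s c0 s0 cs.
  have rot (e : R) : c ^+ 2 + e ^+ 2 = 1 ->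
      bm (fun v => V v * p.[c * tnth v k + e * tnth v i]) /\
      E (fun v => V v * p.[c * tnth v k + e * tnth v i]) = E (fun v => V v * p.[tnth v k]).
    move=> ce; split.
      by apply: bmM => //; apply: bm_horner; apply: bmD; apply: bmZ; exact: bm_coord.
    have bVp : bm (fun v => V v * p.[tnth v k]) by apply: bmM => //; exact: bm_poly.
    have [_ <-] := mean_rot hmu ki ce bVp.
    by apply: eq_mean => v Dv; rewrite Vinv// tnth_rot eqxx.
  have [b1 e1] := rot s cs; have [b2 e2] := rot (- s) ltac:(by rewrite sqrrN).
  have bp : bm (fun v => V v * p.[tnth v k]) by apply: bmM => //; exact: bm_poly.
  rewrite (@eq_mean _ _ mu _ (fun v => 2^-1 * (V v * p.[c * tnth v k + s * tnth v i]
    + V v * p.[c * tnth v k + - s * tnth v i]) - V v * p.[tnth v k])); last first.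
    by move=> v _; rewrite mul0r addr0 mulNr; field.
  by rewrite meanB ?meanZ ?meanD ?e1 ?e2//; [lra|exact: bmD|exact/bmZ/bmD].
apply/eqP; rewrite eq_le ge0// andbT -oppr_ge0 -meanN//; last first.
  by apply: bmM => //; exact: bm_rotd2.
have := ge0 (fun v => - W v) (bmN bW) (fun c s v cs Dv => congr1 -%R (Winv c s v cs Dv)).
by under [X in _ -> 0 <= X]eq_mean do rewrite -mulNr.
Qed.

(** On the sphere the squares of the other coordinates add up to 1 - v_k^2, and N - 1 coordinate
    planes contain the k-th axis. *)
Lemma laplace_sum_rotd2 p v k : D v ->
  (laplace N p).[tnth v k] = \sum_(i | i != k) rotd2 p (tnth v k) (tnth v i).
Proof.
move=> Dv; rewrite horner_laplace /rotd2 sumrB -mulr_suml; congr (_ * _ - _).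
  by rewrite -[1]Dv (bigD1 k)//= addrC addrK.
rewrite sumr_const mulr_natl; congr (_ *+ _).
by rewrite -[in LHS](card_ord N) -(cardC1 k); apply: eq_card => i; rewrite !inE.
Qed.

Lemma mean_laplace p k : E (fun v => (laplace N p).[tnth v k]) = 0.
Proof.
rewrite (eq_mean _ (fun v => laplace_sum_rotd2 p k)) mean_sum//; last first.
  by move=> i _; exact: bm_rotd2.
rewrite big1// => i ik; rewrite -[RHS](@mean_rotd2 (fun=> 1) p k i)//.
- by apply: eq_mean => v _; rewrite mul1r.
- by rewrite eq_sym.
- exact: bm_cst.
Qed.

(** The tangent plane at (x', y') of the concave function sqrt(xy). Being linear in x and y, the
    bound can be averaged over opposite rotations and passed to [second_variation]. *)
Lemma sqrt_tangent (x y x' y' : R) : 0 < x' -> 0 < y' -> 0 <= x -> 0 <= y ->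
  Num.sqrt x * Num.sqrt y
    <= Num.sqrt x' * Num.sqrt y' * (2^-1 * (x / x' + y / y')).
Proof.
move=> x'0 y'0 x0 y0.
have hx : Num.sqrt x = Num.sqrt x' * Num.sqrt (x / x').
  by rewrite -sqrtrM ?ltW// mulrC divfK// gt_eqF.
have hy : Num.sqrt y = Num.sqrt y' * Num.sqrt (y / y').
  by rewrite -sqrtrM ?ltW// mulrC divfK// gt_eqF.
rewrite hx hy mulrACA ler_wpM2l ?mulr_ge0 ?sqrtr_ge0//.
have rx : Num.sqrt (x / x') ^+ 2 = x / x' by rewrite sqr_sqrtr// divr_ge0// ltW.
have ry : Num.sqrt (y / y') ^+ 2 = y / y' by rewrite sqr_sqrtr// divr_ge0// ltW.
move: rx ry; move: (Num.sqrt (x / x')) (Num.sqrt (y / y')) => r t <- <-.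
by have := sqr_ge0 (r - t); rewrite sqrrB; lra.
Qed.

Definition sqrt_prod u v := \prod_(k < N) Num.sqrt (u k).[tnth v k].

Lemma bm_sqrt_prod u : bm (sqrt_prod u).
Proof. by apply: bm_prod => k _; apply: bm_sqrt; exact: bm_poly. Qed.

Lemma sqrt_prod_ge0 u v : 0 <= sqrt_prod u v.
Proof. by apply: prodr_ge0 => k _; exact: sqrtr_ge0. Qed.

Lemma pair_variation_ge0 u b k i : k != i -> 0 < b ->
  (forall j x, `|x| <= 1 -> b <= (u j).[x]) ->
  0 <= E (fun v => sqrt_prod u v / (u k).[tnth v k] * rotd2 (u k) (tnth v k) (tnth v i)
                 + sqrt_prod u v / (u i).[tnth v i] * rotd2 (u i) (tnth v i) (tnth v k)).
Proof.
move=> ki b0 ub.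
have ubv j v : D v -> b <= (u j).[tnth v j] by move=> Dv; apply: ub; exact: sphere_coord.
have bG := bm_sqrt_prod u.
have bu j : bm (fun v => ((u j).[tnth v j])^-1).
  by apply: (bm_inv b0) => [v|]; [exact: ubv|exact: bm_poly].
apply: second_variation; try exact: bmM.
move=> c s c0 s0 cs.
(* [T e] is the tangent bound on the product rotated with sine [e]. In the k-th and i-th factors the
   sine enters with opposite signs, and adding [T s] and [T (- s)] makes both differences
   symmetric. *)
pose T e v := sqrt_prod u v * (2^-1 *
  ((u k).[c * tnth v k + e * tnth v i] / (u k).[tnth v k]
   + (u i).[c * tnth v i + - e * tnth v k] / (u i).[tnth v i])).
have bT e : bm (T e).
  apply: bmM => //; apply: bmZ; apply: bmD; apply: bmM => //; apply: bm_horner;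
   by apply: bmD; apply: bmZ; exact: bm_coord.
have rot e : c ^+ 2 + e ^+ 2 = 1 -> E (sqrt_prod u) <= E (T e).
  move=> ce; have [bGr <-] := mean_rot hmu ki ce bG.
  apply: le_mean => // v Dv; rewrite /T /sqrt_prod.
  have Dr : D (mxact (rotmx k i c e) v) by rewrite -(sphere_rot ki ce) in Dv.
  rewrite (bigD1 k)//= (bigD1 i) 1?eq_sym//= [in leRHS](bigD1 k)//= [in leRHS](bigD1 i) 1?eq_sym//=.
  under eq_bigr => j /andP[/negbTE jk /negbTE ji] do rewrite tnth_rot jk ji.
  set P := \prod_(_ < _ | _) _; have P0 : 0 <= P by apply: prodr_ge0 => j _; exact: sqrtr_ge0.
  have := ubv k _ Dr; have := ubv i _ Dr; have := ubv k _ Dv; have := ubv i _ Dv.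
  have ik : (i == k) = false by rewrite eq_sym (negbTE ki).
  rewrite !tnth_rot ik !eqxx mulNr.
  move: (u k).[_] (u i).[_] (u k).[_] (u i).[_] => x y x' y' yb xb yb' xb'.
  rewrite [leLHS]mulrA [leRHS](_ : _ = Num.sqrt x' * Num.sqrt y' * (2^-1 * (x / x' + y / y')) * P).
    2: by ring.
  rewrite ler_wpM2r// sqrt_tangent//.
  + exact: lt_le_trans b0 xb.
  + exact: lt_le_trans b0 yb.
  + exact: le_trans (ltW b0) xb'.
  + exact: le_trans (ltW b0) yb'.
have := rot s cs; have := rot (- s) ltac:(by rewrite sqrrN).
rewrite -subr_ge0 -meanB// => r1; rewrite -subr_ge0 -meanB// => r2.
have := addr_ge0 r1 r2; rewrite -meanD//; try exact: bmB.
move=> /le_trans; apply; rewrite le_eqVlt; apply/orP; left; apply/eqP.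
apply: eq_mean => v Dv; rewrite /T mulNr opprK.
have /lt0r_neq0 h1 := lt_le_trans b0 (ubv k v Dv).
have /lt0r_neq0 h2 := lt_le_trans b0 (ubv i v Dv).
by rewrite !mulNr; field; rewrite h1 h2.
Qed.

(** This mean is twice the time derivative of the mean of [sqrt_prod u] along the heat flow. *)
Lemma laplace_variation_ge0 u b : 0 < b ->
  (forall j x, `|x| <= 1 -> b <= (u j).[x]) ->
  0 <= E (fun v => sqrt_prod u v *
    \sum_(k < N) (laplace N (u k)).[tnth v k] / (u k).[tnth v k]).
Proof.
move=> b0 ub.
have bu j : bm (fun v => ((u j).[tnth v j])^-1).
  apply: (bm_inv b0) => [v Dv|]; last exact: bm_poly.
  by apply: ub; exact: sphere_coord.
pose T k i v := sqrt_prod u v / (u k).[tnth v k] * rotd2 (u k) (tnth v k) (tnth v i).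
have bT k i : bm (T k i).
  by apply: bmM; [apply: bmM => //; exact: bm_sqrt_prod|exact: bm_rotd2].
rewrite (@eq_mean _ _ _ _ (fun v => \sum_(k < N) \sum_(i < N | i != k) T k i v)); last first.
  move=> v Dv; rewrite mulr_sumr; apply: eq_bigr => k _.
  by rewrite laplace_sum_rotd2// mulr_suml mulr_sumr; apply: eq_bigr => i _; rewrite /T; ring.
rewrite mean_sum//; last by move=> k _; apply: bm_sum.
under eq_bigr do rewrite mean_sum//.
set S := \sum_(_ < _) _.
(* [pair_variation_ge0] controls the term of (k, i) only together with that of (i, k); doubling the
   sum pairs them. *)
suff : 0 <= S + S by lra.
rewrite {2}/S (exchange_big_dep predT)//= /S -big_split/=.
apply: sumr_ge0 => k _.
under [X in _ + X]eq_bigl do rewrite eq_sym.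
rewrite -big_split/=; apply: sumr_ge0 => i ik.
by rewrite -meanD//; apply: (pair_variation_ge0 _ b0); rewrite // eq_sym.
Qed.

Lemma expR_le_quad (y : R) : `|y| <= 2^-1 -> expR y <= 1 + y + 2 * y ^+ 2.
Proof.
move=> y2; have := expR_ge1Dx (- y); rewrite expRN.
have := expR_gt0 y; move: (expR y) => e e0 he.
have : e * (1 - y) <= 1 by rewrite -ler_pdivlMl// mulr1.
move: y2; rewrite ler_norml => /andP[y1 y2] he1.
have y3 : 0 < 1 - y by lra.
rewrite -(ler_pM2r y3); apply: le_trans he1 _.
have -> : (1 + y + 2 * y ^+ 2) * (1 - y) = 1 + y ^+ 2 * (1 - 2 * y) by ring.
by rewrite lerDl mulr_ge0 ?sqr_ge0//; lra.
Qed.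

(** Since u = w (1 - e Lw / w), the inequality 1 + x <= exp x bounds each root of u by the root of w
    times an exponential of the Laplacian at the new state [w]. In the expansion of the product, the
    linear term has the right sign in mean by [laplace_variation_ge0], and the quadratic one is the
    error. *)
Lemma implicit_step (b A B : R) : 0 < b -> 0 <= A -> 0 <= B ->
  exists e0 K, [/\ 0 < e0, 0 <= K & forall e u w, 0 < e -> e <= e0 ->
    (forall k, w k - e *: laplace N (w k) = u k) ->
    (forall k x, `|x| <= 1 -> [/\ b <= (u k).[x], b <= (w k).[x],
       `|(laplace N (w k)).[x]| <= A & (w k).[x] <= B]) ->
    E (sqrt_prod u) <= E (sqrt_prod w) + K * e ^+ 2].
Proof.
(* [a] bounds the sum of the quotients Lw_k / w_k and [G] the product of the roots; e <= 1 / (1 + a)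
   keeps the exponent within the range of [expR_le_quad]. *)
move=> b0 A0 B0; pose a := N%:R * (A / b); pose G := Num.sqrt B ^+ N.
have a0 : 0 <= a by rewrite mulr_ge0// divr_ge0// ltW.
have G0 : 0 <= G by rewrite exprn_ge0// sqrtr_ge0.
exists (1 + a)^-1, (G * a ^+ 2); split; [by rewrite invr_gt0; lra|by rewrite mulr_ge0 ?sqr_ge0|].
move=> e u w e0 ea wu H.
pose S v := \sum_(k < N) (laplace N (w k)).[tnth v k] / (w k).[tnth v k].
have wb k v : D v -> b <= (w k).[tnth v k].
  by move=> /(@sphere_coord _ _ _ k) /(H k)[].
have bw k : bm (fun v => ((w k).[tnth v k])^-1).
  by apply: (bm_inv b0) => [v|]; [exact: wb|exact: bm_poly].
have bS : bm S.
  by apply: bm_sum => k _; apply: bmM => //; exact: bm_poly.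
have Sa v : D v -> `|S v| <= a.
  move=> Dv; apply: le_trans (ler_norm_sum _ _ _) _.
  rewrite /a mulr_natl -[X in _ *+ X](card_ord N) -sumr_const; apply: ler_sum => k _.
  have [_ _ LA _] := H k _ (sphere_coord k Dv).
  rewrite normrM ler_pM// normfV lef_pV2 ?posrE//.
    exact: le_trans (wb k v Dv) (ler_norm _).
  by rewrite normr_gt0 gt_eqF// (lt_le_trans b0)// wb.
have bW := bm_sqrt_prod w.
have var : 0 <= E (fun v => sqrt_prod w v * S v).
  by apply: (laplace_variation_ge0 b0) => k x /(H k)[].
have -> : E (sqrt_prod w) + G * a ^+ 2 * e ^+ 2
    = E (fun v => sqrt_prod w v + (- (e / 2) * (sqrt_prod w v * S v) + G * a ^+ 2 * e ^+ 2))
      + e / 2 * E (fun v => sqrt_prod w v * S v).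
  have bWS := bmM bW bS; have bc := @bm_cst R N (G * a ^+ 2 * e ^+ 2).
  have bZ := bmZ (- (e / 2)) bWS.
  by rewrite (meanD mu bW (bmD bZ bc)) (meanD mu bZ bc) (meanZ mu _ bWS) mean_cst//; ring.
apply: ler_wpDr; first by rewrite mulr_ge0// divr_ge0// ltW.
apply: le_mean; [exact: bm_sqrt_prod| |].
  apply: bmD => //; apply: bmD; last exact: bm_cst.
  by apply: bmZ; exact: bmM.
move=> v Dv.
have le1 : sqrt_prod u v <= sqrt_prod w v * expR (- (e / 2) * S v).
  rewrite /S mulr_sumr expR_sum /sqrt_prod -big_split/=; apply: ler_prod => k _.
  rewrite sqrtr_ge0/=.
  have [ub wbk _ _] := H k _ (sphere_coord k Dv).
  have w0 := lt_le_trans b0 wbk.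
  set y := _ * (_ / _).
  rewrite -(ger0_norm (ltW (expR_gt0 y))) -sqrtr_sqr -sqrtrM ?(ltW w0)//.
  apply: ler_wsqrtr; rewrite -expRM_natl -(wu k) hornerD hornerN hornerZ.
  apply: (@le_trans _ _ ((w k).[tnth v k] * (1 + 2%:R * y))).
    by rewrite /y le_eqVlt; apply/orP; left; apply/eqP; field; rewrite gt_eqF.
  by rewrite ler_pM2l// expR_ge1Dx.
apply: le_trans le1 _.
have eS : `|- (e / 2) * S v| <= e / 2 * a.
  by rewrite normrM normrN [`|e / 2|]ger0_norm ?divr_ge0 ?(ltW e0)// ler_wpM2l ?Sa// divr_ge0// ltW.
have ea1 : e * a <= 1.
  have a1 : 0 < 1 + a by lra.
  have : e * (1 + a) <= 1 by rewrite -ler_pdivlMr// div1r.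
  by have := mulr_ge0 (ltW e0) a0; lra.
have ea2 : e / 2 * a <= 2^-1 by rewrite mulrAC ler_piMl ?invr_ge0.
have q := expR_le_quad (le_trans eS ea2).
apply: le_trans (ler_wpM2l (sqrt_prod_ge0 w v) q) _.
have WG : sqrt_prod w v <= G.
  rewrite /G -[X in _ ^+ X](card_ord N) -prodr_const; apply: ler_prod => k _.
  rewrite sqrtr_ge0/= ler_wsqrtr//; by have [] := H k _ (sphere_coord k Dv).
have sq : (- (e / 2) * S v) ^+ 2 <= (e / 2 * a) ^+ 2.
  by rewrite -real_normK ?num_real// lerXn2r// nnegrE// mulr_ge0// divr_ge0// ltW.
have W0 := sqrt_prod_ge0 w v.
have : sqrt_prod w v * (2 * (- (e / 2) * S v) ^+ 2) <= G * (a ^+ 2 * e ^+ 2).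
  apply: ler_pM => //; first by rewrite mulr_ge0// sqr_ge0.
  apply: (@le_trans _ _ (2 * (e / 2 * a) ^+ 2)); first by rewrite ler_pM2l.
  have -> : 2 * (e / 2 * a) ^+ 2 = a ^+ 2 * e ^+ 2 / 2 by field.
  have := mulr_ge0 (sqr_ge0 a) (sqr_ge0 e); lra.
move: (sqrt_prod w v) (S v) => W s'; rewrite -mulrA; lra.
Qed.

End YoungPositive.

(** * The scheme run for a long time: the inequality for polynomials *)

Section YoungPolynomial.
Variables (R : realType) (N : nat) (mu : probability (N.-tuple R) R).
Hypotheses (hmu : uniform_on_sphere mu) (N2 : (2 <= N)%N).
Implicit Types (v : N.-tuple R) (p : {poly R}) (u w : 'I_N -> {poly R}).
Local Notation D := (@sphere R N).
Local Notation E := (mean mu).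

Lemma le0_of_bounded_multiples (x A : R) : (forall n : nat, n%:R * x <= A) -> x <= 0.
Proof.
move=> H; rewrite leNgt; apply/negP => x0.
have A0 : 0 <= A by have := H 0%N; rewrite mul0r.
have := archi_boundP (divr_ge0 A0 (ltW x0)); rewrite ltr_pdivrMr// ltNge.
by rewrite H.
Qed.

(** Slack is allowed both under each root and outside the product, so that positivity floors,
    time-step errors and approximation errors can all be charged to one [t]. *)
Lemma le_prod_sqrt (a : 'I_N -> R) (X : R) :
  (forall t, 0 < t -> X <= \prod_(k < N) Num.sqrt (a k + t) + t) ->
  X <= \prod_(k < N) Num.sqrt (a k).
Proof.
move=> Xa; pose f (r : seq 'I_N) t := \prod_(k <- r) Num.sqrt (a k + t).
have cf r : continuous (f r).
  elim: r => [|k r IH] t.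
    by rewrite (_ : f [::] = fun=> 1); [exact: cvg_cst|apply/funext => s; rewrite /f big_nil].
  rewrite (_ : f (k :: r) = (fun s => Num.sqrt (a k + s)) \* f r); last first.
    by apply/funext => s; rewrite /f big_cons.
  apply: continuousM; last exact: IH.
  apply: continuous_comp; last exact: sqrt_continuous.
  by apply: cvgD; [exact: cvg_cst|exact: cvg_id].
have cF : f (index_enum 'I_N) t + t @[t --> 0^'+] --> f (index_enum 'I_N) 0 + 0.
  by apply: cvg_at_right_filter; apply: cvgD; [exact: cf|exact: cvg_id].
have := cvgr_to_ge cF; rewrite /f addr0 => /(_ _ X).
under [X in _ <= X]eq_bigr do rewrite addr0.
apply; near=> t; apply: Xa; near: t; exact: nbhs_right_gt.
Unshelve. all: by end_near. Qed.

Lemma mean_dist f (m t : R) : bm f -> (forall v, D v -> `|f v - m| <= t) ->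
  `|E f - m| <= t.
Proof.
move=> bf fm; rewrite -(mean_cst hmu m) -meanB//; last exact: bm_cst.
have bd : bm (fun v => f v - m) by apply: bmB => //; exact: bm_cst.
have lo : E (fun=> - t) <= E (fun v => f v - m).
  by apply: le_mean => //; [exact: bm_cst|move=> v /fm; rewrite ler_norml => /andP[]].
have hi : E (fun v => f v - m) <= E (fun=> t).
  by apply: le_mean => //; [exact: bm_cst|move=> v /fm; rewrite ler_norml => /andP[]].
by move: lo hi; rewrite !mean_cst// ler_norml => -> ->.
Qed.

Lemma mean_laplace_step p q (e : R) k : q - e *: laplace N q = p ->
  E (fun v => q.[tnth v k]) = E (fun v => p.[tnth v k]).
Proof.
move=> <-; rewrite [RHS](@eq_mean _ _ _ _
    (fun v => q.[tnth v k] - e * (laplace N q).[tnth v k])); last first.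
  by move=> v _; rewrite hornerD hornerN hornerZ.
rewrite meanB ?meanZ ?mean_laplace ?mulr0 ?subr0//; try exact: bm_poly.
by apply: bmZ; exact: bm_poly.
Qed.

(* Along the flow the left side increases, while all [u k] converge to their
   means. *)
Lemma young_pos_poly u b : 0 < b -> (forall k x, `|x| <= 1 -> b <= (u k).[x]) ->
  E (sqrt_prod u) <= \prod_(k < N) Num.sqrt (E (fun v => (u k).[tnth v k])).
Proof.
move=> b0 ub.
have /choice[mA mAP] : forall k, exists mA : R * R, 0 <= mA.2 /\ forall e : R, 0 < e ->
    exists U : nat -> {poly R}, [/\ U 0%N = u k,
      forall r, U r.+1 - e *: laplace N (U r.+1) = U r,
      forall r x, `|x| <= 1 -> `|(laplace N (U r)).[x]| <= mA.2 &
      forall r x, `|x| <= 1 -> `|(U r).[x] - mA.1| <= mA.2 / (1 + r%:R * e)].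
  by move=> k; have [m [A [A0 H]]] := implicit_euler N2 (u k); exists (m, A); exact: (conj A0 H).
pose m k := (mA k).1; pose A := \sum_(k < N) (mA k).2.
have Ak k : (mA k).2 <= A.
  by rewrite /A (bigD1 k)//= lerDl sumr_ge0// => i _; exact: (mAP i).1.
have A0 : 0 <= A by apply: sumr_ge0 => k _; exact: (mAP k).1.
pose B := \sum_(k < N) `|m k| + A.
have B0 : 0 <= B by rewrite addr_ge0// sumr_ge0.
have [e0 [K [e00 K0 step]]] := implicit_step hmu b0 A0 B0.
have flow e : 0 < e -> exists U : nat -> 'I_N -> {poly R}, [/\ U 0%N = u,
      forall r k, U r.+1 k - e *: laplace N (U r.+1 k) = U r k,
      forall r k x, `|x| <= 1 -> `|(laplace N (U r k)).[x]| <= A &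
      forall r k x, `|x| <= 1 -> `|(U r k).[x] - m k| <= A / (1 + r%:R * e)].
  move=> e1; have /choice[U UP] := fun k => (mAP k).2 e e1.
  exists (fun r k => U k r); split.
  - by apply/funext => k; have [] := UP k.
  - by move=> r k; have [] := UP k.
  - by move=> r k x x1; have [_ _ /(_ r x x1) H _] := UP k; exact: le_trans H (Ak k).
  - move=> r k x x1; have [_ _ _ /(_ r x x1) H] := UP k.
    apply: le_trans H _; rewrite ler_wpM2r// invr_ge0.
    by rewrite addr_ge0// mulr_ge0// ltW.
(* The scheme preserves means while [U r k] tends to [m k]; step size 1 is enough to see this. *)
have mE k : m k = E (fun v => (u k).[tnth v k]).
  have [U [U0 US _ Um]] := flow 1 ltr01.
  apply/eqP; rewrite eq_sym -subr_eq0 -normr_le0.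
  apply: (@le0_of_bounded_multiples _ A) => r.
  have -> : E (fun v => (u k).[tnth v k]) = E (fun v => (U r k).[tnth v k]).
    elim: r => [|r ->]; first by rewrite U0.
    by rewrite (mean_laplace_step k (US r k)).
  have : `|E (fun v => (U r k).[tnth v k]) - m k| <= A / (1 + r%:R * 1).
    by apply: mean_dist => [|v Dv]; [exact: bm_poly|exact/Um/sphere_coord].
  by rewrite mulr1 ler_pdivlMr//; have := normr_ge0 (E (fun v => (U r k).[tnth v k]) - m k); nra.
under eq_bigr do rewrite -mE.
apply: le_prod_sqrt => t t0.
(* By time [j] every factor is within [t] of its mean. *)
pose j := Num.bound (A / t); have jt : A / (1 + j%:R) <= t.
  rewrite ler_pdivrMr; last by rewrite ltr_pwDl.
  have := archi_boundP (divr_ge0 A0 (ltW t0)); rewrite -/j ltr_pdivrMr// => Aj.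
  by rewrite mulrDr mulr1 [t * _]mulrC; lra.
(* With n > c steps of size 1/n per unit of time, the first summand ensures e <= e0 and the second
   bounds the accumulated error n j K e^2 = K j / n by [t]. *)
pose c := e0^-1 + K * j%:R / t.
have c0 : 0 < c by rewrite ltr_pwDl ?invr_gt0// divr_ge0 ?mulr_ge0// ltW.
pose n := Num.bound c; have cn : c < n%:R := archi_boundP (ltW c0).
have n0 : (0 : R) < n%:R := lt_trans c0 cn.
pose e : R := n%:R^-1; have e1 : 0 < e by rewrite invr_gt0.
have ee0 : e <= e0.
  rewrite -[e0]invrK lef_pV2 ?posrE ?invr_gt0//; apply: le_trans (ltW cn).
  by rewrite lerDl divr_ge0 ?mulr_ge0// ltW.
have [U [U0 US UL Um]] := flow e e1.
have Ub r k x : `|x| <= 1 -> b <= (U r k).[x].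
  elim: r k x => [|r IH] k x x1; first by rewrite U0 ub.
  apply: (@resolvent_ge _ _ N2 (U r.+1 k) e b (ltW e1)) => // y y1.
  by rewrite US; exact: IH.
have UB r k x : `|x| <= 1 -> (U r k).[x] <= B.
  move=> /(Um r k); rewrite ler_norml => /andP[_ H].
  have re : 1 <= 1 + r%:R * e by rewrite lerDl mulr_ge0// ltW.
  have A1 : A / (1 + r%:R * e) <= A by rewrite ler_piMr// invf_le1// (lt_le_trans ltr01).
  have mB : m k <= \sum_(k < N) `|m k|.
    by rewrite (bigD1 k)//= ler_wpDr ?sumr_ge0// ler_norm.
  by rewrite /B; lra.
have iter r : E (sqrt_prod u) <= E (sqrt_prod (U r)) + r%:R * (K * e ^+ 2).
  elim: r => [|r IH]; first by rewrite U0 mul0r addr0.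
  apply: le_trans IH _; rewrite -natr1 mulrDl mul1r [r%:R * _ + _]addrC addrA lerD2r.
  apply: (step e (U r) (U r.+1)) => // k x x1.
  by split; [exact: Ub|exact: Ub|exact: UL|exact: UB].
apply: le_trans (iter (n * j)%N) _; apply: lerD.
  rewrite -[leRHS](mean_cst hmu); apply: le_mean; [exact: bm_sqrt_prod|exact: bm_cst|].
  move=> v Dv; apply: ler_prod => k _; rewrite sqrtr_ge0/= ler_wsqrtr//.
  have := Um (n * j)%N k _ (sphere_coord k Dv); rewrite ler_norml => /andP[_].
  by rewrite natrM mulrAC mulfV ?gt_eqF// mul1r; lra.
have -> : (n * j)%:R * (K * e ^+ 2) = K * j%:R / n%:R.
  by rewrite natrM /e; field; rewrite gt_eqF.
rewrite ler_pdivrMr// -ler_pdivrMl// mulrC; apply: le_trans (ltW cn).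
by rewrite lerDr invr_ge0 ltW.
Qed.

(** Squares may vanish, and adding [t] supplies the positive floor that the flow needs. *)
Lemma young_poly (p : 'I_N -> {poly R}) :
  E (fun v => \prod_(k < N) (p k).[tnth v k])
    <= \prod_(k < N) Num.sqrt (E (fun v => (p k).[tnth v k] ^+ 2)).
Proof.
apply: le_prod_sqrt => t t0.
pose u k := p k ^+ 2 + t%:P.
have uE k x : (u k).[x] = (p k).[x] ^+ 2 + t by rewrite /u hornerD horner_exp hornerC.
have := @young_pos_poly u t t0; under eq_bigr => k _.
  rewrite (@eq_mean _ _ _ _ (fun v => (p k).[tnth v k] ^+ 2 + t)); last first.
    by move=> v _; rewrite uE.
  rewrite meanD ?mean_cst//; [|exact/bmX/bm_poly|exact: bm_cst].
  over.
move=> H; apply: (@le_trans _ _ (E (sqrt_prod u))).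
  apply: le_mean; [by apply: bm_prod => k _; exact: bm_poly|exact: bm_sqrt_prod|].
  move=> v Dv; apply: le_trans (ler_norm _) _; rewrite normr_prod.
  apply: ler_prod => k _; rewrite normr_ge0/= -sqrtr_sqr ler_wsqrtr// uE lerDl ltW//.
apply: le_trans (H _) _; last by rewrite lerDl ltW.
by move=> k x _; rewrite uE lerDr sqr_ge0.
Qed.

End YoungPolynomial.

(** * Density of polynomials and the inequality for bounded functions *)

Section PolynomialDensity.
Variable R : realType.

(* [(1 - w ^ m) ^ (2 ^ m)] is a polynomial in [w] that switches from 1 to 0
   at [w = 1 / 2]. *)
Lemma switch_small (w c : R) m : 0 <= w -> w <= 1 -> 0 <= c -> 1 + c <= 2 * w ->
  0 <= (1 - w ^+ m) ^+ (2 ^ m) <= (1 + m%:R * c)^-1.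
Proof.
move=> w0 w1 c0 cw; have wm1 : w ^+ m <= 1 by rewrite exprn_ile1.
have wm0 : 0 <= w ^+ m by rewrite exprn_ge0.
rewrite exprn_ge0 ?subr_ge0//=.
have mc : 0 < 1 + m%:R * c by rewrite ltr_pwDl// mulr_ge0.
rewrite -[leRHS]mul1r ler_pdivlMr//.
(* By the Bernoulli inequality the second factor is at least 1 + (2w)^m, hence at least 1 + mc,
   while the whole product is at most 1. *)
apply: (@le_trans _ _ ((1 - w ^+ m) ^+ (2 ^ m) * (1 + w ^+ m) ^+ (2 ^ m))).
  rewrite ler_wpM2l ?exprn_ge0 ?subr_ge0//.
  apply: le_trans (@bernoulli_ineq _ (w ^+ m) (2 ^ m)%N ltac:(lra)).
  rewrite lerD2l natrX -exprMn.
  apply: (@le_trans _ _ ((1 + c) ^+ m)).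
    by apply: le_trans (@bernoulli_ineq _ c m ltac:(lra)); lra.
  by rewrite lerXn2r// nnegrE; lra.
rewrite -exprMn exprn_ile1//.
  by rewrite mulr_ge0 ?subr_ge0 ?addr_ge0.
have -> : (1 - w ^+ m) * (1 + w ^+ m) = 1 - w ^+ m * w ^+ m by ring.
by rewrite gerBl mulr_ge0.
Qed.

(** Bernoulli gives the lower bound 1 - (2w)^m, and (1 - c)^m (1 + c)^m <= 1 turns (1 - c)^m into a
    rate in m. *)
Lemma switch_large (w c : R) m : 0 <= w -> 0 <= c -> 2 * w <= 1 - c ->
  1 - (1 + m%:R * c)^-1 <= (1 - w ^+ m) ^+ (2 ^ m) <= 1.
Proof.
move=> w0 c0 cw; have wm0 : 0 <= w ^+ m by rewrite exprn_ge0.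
have wm1 : w ^+ m <= 1 by rewrite exprn_ile1//; lra.
rewrite exprn_ile1 ?subr_ge0// ?gerBl// andbT.
have mc : 0 < 1 + m%:R * c by rewrite ltr_pwDl// mulr_ge0.
apply: (@le_trans _ _ (1 + (2 ^ m)%:R * - (w ^+ m))); last first.
  by apply: bernoulli_ineq; lra.
rewrite mulrN lerD2l lerN2 natrX -exprMn -[leRHS]mul1r ler_pdivlMr//.
apply: (@le_trans _ _ ((1 - c) ^+ m * (1 + c) ^+ m)).
  apply: ler_pM; rewrite ?exprn_ge0 ?mulr_ge0//; first exact: ltW.
    by rewrite lerXn2r// nnegrE; lra.
  by apply: bernoulli_ineq; lra.
have c1 : 0 <= 1 - c by lra.
rewrite -exprMn exprn_ile1//; first by rewrite mulr_ge0// addr_ge0.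
have -> : (1 - c) * (1 + c) = 1 - c * c by ring.
by rewrite gerBl mulr_ge0.
Qed.

Lemma poly_to_ray (a : R) : exists p : nat -> {poly R},
  (forall n t, `|t| <= 1 -> `|(p n).[t]| <= 1) /\
  (forall t, `|t| <= 1 -> (p n).[t] @[n --> \oo] --> (\1_(`]-oo, a[) t : R)).
Proof.
pose k : R := (`|a| + 2)^-1.
have a2 : 0 < `|a| + 2 by rewrite ltr_wpDl.
have k0 : 0 < k by rewrite invr_gt0.
have k1 : k <= 1 by rewrite invf_le1//; have := normr_ge0 a; lra.
pose d n : R := n.+1%:R^-1.
have d0 n : 0 < d n by rewrite invr_gt0.
have d1 n : d n <= 1 by rewrite invf_le1// ler1n.
(* [k] keeps [W n] in [0, 1] on [-1, 1]. The crossing of 1/2 is shifted to a - d n so that t = a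
   falls on the side where the switch is small, as the open ray requires; the exponent n^2 outweighs
   the shrinking gap k d n. *)
pose W n : {poly R} := 2^-1 *: (1 + k *: ('X - a%:P + (d n)%:P)).
have WE n t : 2 * (W n).[t] = 1 + k * (t - a + d n).
  by rewrite /W !(hornerZ, hornerD, hornerN, hornerX, hornerC); field.
have W01 n t : `|t| <= 1 -> 0 <= (W n).[t] <= 1.
  move=> t1; have H := WE n t.
  have : k * `|t - a + d n| <= 1.
    rewrite mulrC ler_pdivrMr// mul1r.
    apply: le_trans (ler_normD _ _) _; rewrite (gtr0_norm (d0 n)).
    by have := ler_normB t a; have := d1 n; lra.
  rewrite -{1}(gtr0_norm k0) -normrM ler_norml.
  by move: H; lra.
exists (fun n => (1 - W n ^+ (n * n)) ^+ (2 ^ (n * n))).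
have pE n t : ((1 - W n ^+ (n * n)) ^+ (2 ^ (n * n))).[t]
    = (1 - (W n).[t] ^+ (n * n)) ^+ (2 ^ (n * n)) by rewrite !(hornerE, horner_exp).
split=> [n t t1|t t1].
  have /andP[w0 w1] := W01 n t t1.
  by rewrite pE normrX exprn_ile1// ger0_norm ?gerBl ?exprn_ge0// subr_ge0 exprn_ile1.
have err n : (0 < n)%N -> (1 + (n * n)%:R * (k * d n))^-1 <= (1 + n.-1%:R * k)^-1.
  move=> n0; rewrite lef_pV2 ?posrE ?ltr_pwDl ?mulr_ge0 ?(ltW k0) ?(ltW (d0 n))//.
  rewrite lerD2l mulrCA mulrC; apply: ler_wpM2l; first exact: ltW.
  by rewrite /d ler_pdivlMr// -natrM ler_nat; nia.
have cvg0 : (1 + n.-1%:R * k)^-1 @[n --> \oo] --> (0 : R).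
  apply/cvgrPdist_le => e e0.
  pose m := Num.bound ((e * k)^-1).
  exists m.+1 => // n /= mn; rewrite sub0r normrN gtr0_norm; last first.
    by rewrite invr_gt0 ltr_pwDl// mulr_ge0// ltW.
  rewrite -[e]invrK lef_pV2 ?posrE ?invr_gt0// ?ltr_pwDl// ?mulr_ge0// ?(ltW k0)//.
  have : (e * k)^-1 < m%:R by apply: archi_boundP; rewrite invr_ge0 ltW// mulr_gt0.
  have : m%:R <= n.-1%:R :> R by rewrite ler_nat; lia.
  rewrite invfM -ltr_pdivlMr ?invr_gt0// invrK; nra.
apply/cvgrPdist_le => e e0.
have /cvgrPdist_le/(_ e e0) near0 := cvg0.
have [ta|ta] := ltP t a.
  have dt : 0 < a - t by rewrite subr_gt0.
  pose m := Num.bound (2 / (a - t)).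
  near=> n; rewrite pE indicE mem_set/=; last by rewrite in_itv.
  have n0 : (0 < n)%N by near: n; exact: nbhs_infty_gt.
  have /andP[w0 w1] := W01 n t t1.
  have dn : d n <= (a - t) / 2.
    have mn : (m <= n)%N by near: n; exact: nbhs_infty_ge.
    have : 2 / (a - t) < m%:R by apply: archi_boundP; rewrite divr_ge0// ltW.
    rewrite ltr_pdivrMr// => H.
    rewrite /d invf_ple ?posrE ?divr_gt0// invf_div.
    have : m%:R <= n.+1%:R :> R by rewrite ler_nat; lia.
    by rewrite ler_pdivrMr//; nra.
  have /andP[q0 q1] := @switch_large (W n).[t] (k * d n) (n * n)%N w0
    (mulr_ge0 (ltW k0) (ltW (d0 n))) ltac:(by rewrite WE; nra).
  have ne : `|0 - (1 + n.-1%:R * k)^-1| <= e by near: n.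
  move: ne; rewrite sub0r normrN => ne.
  rewrite ger0_norm ?subr_ge0//; apply: le_trans ne; apply: le_trans (ler_norm _).
  by apply: le_trans (err n n0); rewrite lerBlDl -lerBlDr.
near=> n; rewrite pE indicE memNset/=; last by rewrite in_itv/= ltNge ta.
have n0 : (0 < n)%N by near: n; exact: nbhs_infty_gt.
have /andP[w0 w1] := W01 n t t1.
have /andP[q0 q1] := @switch_small (W n).[t] (k * d n) (n * n)%N w0 w1
    (mulr_ge0 (ltW k0) (ltW (d0 n))) ltac:(by rewrite WE; nra).
have ne : `|0 - (1 + n.-1%:R * k)^-1| <= e by near: n.
move: ne; rewrite sub0r normrN => ne.
rewrite sub0r normrN ger0_norm//; apply: le_trans ne; apply: le_trans (ler_norm _).
exact: le_trans q1 (err n n0).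
Unshelve. all: by end_near. Qed.

End PolynomialDensity.

(** * Mean-square approximation of bounded functions of one coordinate by polynomials *)

Section Young.
Variables (R : realType) (N : nat) (mu : probability (N.-tuple R) R).
Hypotheses (hmu : uniform_on_sphere mu) (N2 : (2 <= N)%N).
Implicit Types (v : N.-tuple R) (p : {poly R}) (g h : R -> R).
Local Notation D := (@sphere R N).
Local Notation E := (mean mu).

Lemma mean_cvg (F : nat -> N.-tuple R -> R) f M :
  (forall n, measurable_fun D (F n)) -> bm f ->
  (forall n v, D v -> `|F n v| <= M) ->
  (forall v, D v -> F n v @[n --> \oo] --> f v) ->
  E (F n) @[n --> \oo] --> E f.
Proof.
move=> mF bf FM Ff.
have mD : measurable D by exact: measurable_sphere.
have [mf _] := bf.
have [|||||_ _] := @dominated_convergence _ _ _ mu D mD (fun n v => (F n v)%:E)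
  (EFin \o f) (fun=> M%:E).
- by move=> n; apply/measurable_EFinP; exact: mF.
- by apply/measurable_EFinP.
- by apply: aeW => v Dv; apply: cvg_EFin; [near=> n|exact: Ff].
- exact: (bm_integrable mu (bm_cst N M)).
- by apply: aeW => v n Dv; rewrite lee_fin; exact: FM.
rewrite -EFin_mean// => H; exact: fine_cvg H.
Unshelve. all: by end_near. Qed.

Definition mb h := measurable_fun `[(-1 : R), 1] h /\
  exists M, forall t, -1 <= t <= 1 -> `|h t| <= M.

Lemma bm_mb h i : mb h -> bm (fun v => h (tnth v i)).
Proof. by move=> [mh hM]; exact: bm_comp. Qed.

Lemma mb_poly p : mb (horner p).
Proof.
split; first exact: measurable_poly.
by have [M _ pM] := horner_bounded p 1; exists M => t; rewrite -ler_norml; exact: pM.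
Qed.

Variable k : 'I_N.

Definition L2_approx h := mb h /\ forall e, 0 < e ->
  exists p, E (fun v => (p.[tnth v k] - h (tnth v k)) ^+ 2) <= e.

Lemma bm_sqdist p h : mb h -> bm (fun v => (p.[tnth v k] - h (tnth v k)) ^+ 2).
Proof. by move=> mh; apply/bmX/bmB; [exact: bm_poly|exact: bm_mb]. Qed.

Lemma L2_approx_poly p : L2_approx (horner p).
Proof.
split; first exact: mb_poly.
move=> e e0; exists p; rewrite (@eq_mean _ _ _ _ (fun=> 0)).
  by rewrite mean_cst// ltW.
by move=> v _; rewrite subrr expr0n.
Qed.

Lemma L2_approx_lin (a : R) g h : L2_approx g -> L2_approx h ->
  L2_approx (fun t => a * g t + h t).
Proof.
move=> [[mg [A gA]] ga] [[mh [B hB]] ha]; split.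
  split; first by apply: measurable_funD => //; exact: measurable_funM.
  exists (`|a| * A + B) => t t1; apply: le_trans (ler_normD _ _) _.
  by rewrite normrM lerD ?hB// ler_wpM2l// gA.
move=> e e0.
have a20 : 0 < 1 + a ^+ 2 by rewrite ltr_pwDl// sqr_ge0.
pose d := e / 4 / (1 + a ^+ 2).
have d0 : 0 < d by rewrite !divr_gt0.
have [p gp] := ga d d0; have [q hq] := ha (e / 4) (divr_gt0 e0 (ltr0n _ 4)).
exists (a *: p + q).
have bp : bm (fun v => (p.[tnth v k] - g (tnth v k)) ^+ 2).
  by apply: bm_sqdist; split => //; exists A.
have bq : bm (fun v => (q.[tnth v k] - h (tnth v k)) ^+ 2).
  by apply: bm_sqdist; split => //; exists B.
apply: (@le_trans _ _ (E (fun v => 2 * a ^+ 2 * (p.[tnth v k] - g (tnth v k)) ^+ 2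
    + 2 * (q.[tnth v k] - h (tnth v k)) ^+ 2))).
  apply: le_mean.
  - apply: (@bm_sqdist _ (fun t => a * g t + h t)); split; first by apply: measurable_funD => //; exact: measurable_funM.
    exists (`|a| * A + B) => t t1; apply: le_trans (ler_normD _ _) _.
    by rewrite normrM lerD ?hB// ler_wpM2l// gA.
  - by apply: bmD; exact: bmZ.
  move=> v Dv; rewrite hornerD hornerZ.
  move: p.[_] q.[_] (g _) (h _) => x y z w.
  have := sqr_ge0 (a * (x - z) - (y - w)).
  move=> H; rewrite -subr_ge0; apply: le_trans H _; rewrite le_eqVlt; apply/orP; left.
  by apply/eqP; ring.
rewrite meanD ?meanZ//; try exact: bmZ.
have : 2 * a ^+ 2 * E (fun v => (p.[tnth v k] - g (tnth v k)) ^+ 2) <= e / 2.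
  apply: (@le_trans _ _ (2 * a ^+ 2 * d)); first by rewrite ler_wpM2l// mulr_ge0// sqr_ge0.
  have -> : 2 * a ^+ 2 * d = e / 2 * (a ^+ 2 / (1 + a ^+ 2)).
    by rewrite /d; field; rewrite gt_eqF.
  by rewrite ler_piMr// ?divr_ge0 ?(ltW e0)// ler_pdivrMr// mul1r; lra.
lra.
Qed.

Lemma L2_approx_lim (H : nat -> R -> R) h M : (forall n, L2_approx (H n)) ->
  measurable_fun `[(-1 : R), 1] h ->
  (forall n t, -1 <= t <= 1 -> `|H n t| <= M) ->
  (forall t, -1 <= t <= 1 -> H n t @[n --> \oo] --> h t) -> L2_approx h.
Proof.
move=> Ha mh HM Hh.
have hM t : -1 <= t <= 1 -> `|h t| <= M.
  move=> t1; apply: (cvgr_to_le (cvg_norm (Hh t t1))).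
  by near=> n; exact: HM.
have bh : mb h by split => //; exists M.
split => // e e0.
have : E (fun v => (H n (tnth v k) - h (tnth v k)) ^+ 2) @[n --> \oo] --> E (fun=> 0).
  apply: (@mean_cvg _ _ ((M + M) ^+ 2)).
  - move=> n; have [bn _] := Ha n.
    by have [] : bm (fun v => (H n (tnth v k) - h (tnth v k)) ^+ 2)
      by apply/bmX/bmB; exact: bm_mb.
  - exact: bm_cst.
  - move=> n v /(@sphere_coord _ _ _ k); rewrite ler_norml => vk.
    rewrite normrX lerXn2r ?nnegrE//; last first.
      by apply: le_trans (ler_normB _ _) _; rewrite lerD ?HM ?hM.
    by have := le_trans (normr_ge0 _) (hM _ vk) => M0; rewrite addr_ge0.
  move=> v /(@sphere_coord _ _ _ k); rewrite ler_norml => vk.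
  have Hc : H n (tnth v k) - h (tnth v k) @[n --> \oo] --> (0 : R).
    by rewrite -(subrr (h (tnth v k))); apply: cvgB; [exact: Hh|exact: cvg_cst].
  by rewrite -(mulr0 (0 : R)); exact: (cvgM Hc Hc).
rewrite mean_cst// => /cvgrPdist_le/(_ (e / 4) (divr_gt0 e0 (ltr0n _ 4)))[n _ /(_ n (leqnn n))].
rewrite sub0r normrN => /(le_trans (ler_norm _)) Hn.
have [bn /(_ (e / 4) (divr_gt0 e0 (ltr0n _ 4)))[p pn]] := Ha n.
exists p.
have b1 := bm_sqdist p bn.
have b2 : bm (fun v => (H n (tnth v k) - h (tnth v k)) ^+ 2).
  by apply/bmX/bmB; exact: bm_mb.
apply: (@le_trans _ _ (E (fun v => 2 * (p.[tnth v k] - H n (tnth v k)) ^+ 2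
    + 2 * (H n (tnth v k) - h (tnth v k)) ^+ 2))).
  apply: le_mean; [exact: bm_sqdist|by apply: bmD; exact: bmZ|].
  move=> v _; move: p.[_] (H _ _) (h _) => x y z.
  have := sqr_ge0 ((x - y) - (y - z)); nra.
rewrite meanD ?meanZ//; try exact: bmZ.
lra.
Unshelve. all: by end_near. Qed.

(** A pi-lambda argument: approximable indicators are stable under proper differences and increasing
    unions, and [poly_to_ray] handles the open left rays, which generate the Borel sets. *)
Lemma L2_approx_indic A : measurable A -> L2_approx (\1_A : R -> R).
Proof.
have poly0 : L2_approx (fun=> 0).
  by have := L2_approx_poly 0; congr L2_approx; apply/funext => t; rewrite horner0.
have poly1 : L2_approx (fun=> 1).
  by have := L2_approx_poly 1; congr L2_approx; apply/funext => t; rewrite hornerC.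
pose H := [set A : set R | measurable A /\ L2_approx (\1_A : R -> R)].
suff GH : <<s (@RGenInftyO.G R) >> `<=` H.
  move=> mA; have : (RGenInftyO.G (R:=R)).-sigma.-measurable A.
    by rewrite -RGenInftyO.measurableE.
  by move=> /GH[].
apply: lambda_system_subset => //.
- move=> _ _ [x ->] [y ->]; exists (Num.min x y).
  by apply/seteqP; split => t /=; rewrite !in_itv/= lt_min => /andP.
- split => //.
  + split; first exact: measurableT.
    by move: poly1; congr L2_approx; apply/funext => t; rewrite indicT.
  + move=> A' B BA [mA aA] [mB aB]; split; first exact: measurableD.
    have := L2_approx_lin (-1) aB aA; congr L2_approx; apply/funext => t.
    rewrite !indicE in_setD; case: (boolP (t \in B)) => /= tB.
      by rewrite (_ : t \in A') ?mulr1 ?addNr// inE; apply: BA; rewrite -inE.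
    by rewrite mulr0 add0r andbT.
  + move=> F ndF FH; split; first by apply: bigcupT_measurable => n; exact: (FH n).1.
    apply: (@L2_approx_lim (fun n => \1_(F n)) _ 1 (fun n => (FH n).2)).
    * by apply: measurable_indic; apply: bigcupT_measurable => n; exact: (FH n).1.
    * by move=> n t _; rewrite indicE; case: (_ \in _); rewrite ?normr1 ?normr0.
    move=> t _; rewrite indicE; have [[m _ Fm]|tF] := pselect ((\bigcup_i F i) t).
      rewrite mem_set; last by exists m.
      apply: cvg_near_cst; exists m => // n /= mn; rewrite indicE mem_set//.
      by have /subsetPset := ndF _ _ mn; exact.
    rewrite memNset//; apply: cvg_near_cst; near=> n.
    by rewrite indicE memNset// => Fn; apply: tF; exists n.
- move=> _ [x ->]; split; first exact: measurable_itv.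
  have [p [p1 pc]] := poly_to_ray x.
  apply: (@L2_approx_lim (fun n => horner (p n)) _ 1).
  + by move=> n; exact: L2_approx_poly.
  + exact: measurable_indic.
  + by move=> n t t1; apply: p1; rewrite ler_norml.
  + by move=> t t1; apply: pc; rewrite ler_norml.
Unshelve. all: by end_near. Qed.

Import HBNNSimple.

Lemma L2_approx_bounded h : mb h -> L2_approx h.
Proof.
move=> [mh [M hM]].
(* The shift makes the function nonnegative, so it is an increasing limit of simple functions; it is
   undone in [aG]. *)
pose f t := (h t + M)%:E.
have mf : measurable_fun `[(-1 : R), 1] f.
  by apply/measurable_EFinP; exact: measurable_funD.
have mI : measurable (`[(-1 : R), 1]%classic : set R) by exact: measurable_itv.
have f0 t : `[(-1 : R), 1]%classic t -> (0 <= f t)%E.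
  by rewrite /= in_itv/= lee_fin => /hM; rewrite ler_norml; lra.
pose G := nnsfun_approx mI mf.
have aG n : L2_approx (fun t => 1 * G n t + - M).
  have aM : L2_approx (fun=> - M).
    by have := L2_approx_poly (- M)%:P; congr L2_approx; apply/funext => t; rewrite hornerC.
  apply: L2_approx_lin => //.
  pose c : seq R := finmap.enum_fset (fset_set (range (G n))).
  rewrite (_ : (G n : R -> R) = fun t =>
      \sum_(i < size c) c`_i * \1_(G n @^-1` [set c`_i]) t); last first.
    by apply/funext => t; rewrite fimfunEord.
  move: (index_enum _) => s; elim: s => [|i s IH].
    have := L2_approx_poly 0; congr L2_approx; apply/funext => t.
    by rewrite big_nil horner0.
  under eq_fun do rewrite big_cons.
  by apply: L2_approx_lin => //; exact: L2_approx_indic.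
apply: (@L2_approx_lim _ _ (`|M| + M + `|M|) aG) => //.
- move=> n t t1; rewrite mul1r; apply: le_trans (ler_normB _ _) _; rewrite lerD2r.
  rewrite ger0_norm// -lee_fin /G nnsfun_approxE.
  apply: le_trans (le_approx n f0 _) _; first by rewrite /= in_itv.
  by rewrite lee_fin lerD2r; apply: le_trans (ler_norm _) _; apply: le_trans (hM t t1) _; exact: ler_norm.
move=> t t1.
have tI : `[(-1 : R), 1]%classic t by rewrite /= in_itv.
have := cvg_nnsfun_approx mI mf f0 tI; rewrite /f => /fine_cvg c1.
have -> : h t = 1 * (h t + M) + - M by ring.
apply: cvgD; last exact: cvg_cst.
by apply: cvgM; [exact: cvg_cst|exact: c1].
Qed.

End Young.

(** * From polynomials to bounded functions *)

Section YoungBounded.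
Variables (R : realType) (N : nat) (mu : probability (N.-tuple R) R).
Hypotheses (hmu : uniform_on_sphere mu) (N2 : (2 <= N)%N).
Implicit Types (v : N.-tuple R) (p : {poly R}) (g : 'I_N -> R -> R) (h : R -> R).
Local Notation D := (@sphere R N).
Local Notation E := (mean mu).

Definition young_for g := E (fun v => \prod_(k < N) g k (tnth v k))
  <= \prod_(k < N) Num.sqrt (E (fun v => g k (tnth v k) ^+ 2)).

Definition upd g (i : 'I_N) h k := if k == i then h else g k.

Lemma young_upd g i : (forall k, mb (g k)) ->
  (forall p, young_for (upd g i (horner p))) -> young_for g.
Proof.
move=> bg yp; apply: le_prod_sqrt => t t0.
pose W v := \prod_(k < N | k != i) g k (tnth v k).
have bW : bm W by apply: bm_prod => k _; exact: bm_mb.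
pose C := \prod_(k < N | k != i) Num.sqrt (E (fun v => g k (tnth v k) ^+ 2)).
have C0 : 0 <= C by apply: prodr_ge0 => k _; exact: sqrtr_ge0.
have {}yp p : E (fun v => p.[tnth v i] * W v)
    <= Num.sqrt (E (fun v => p.[tnth v i] ^+ 2)) * C.
  have := yp p; rewrite /young_for /upd [X in _ <= X](bigD1 i)//= eqxx.
  rewrite [X in _ <= _ * X](_ : _ = C); last by apply: eq_bigr => k /negbTE ->.
  apply: le_trans; rewrite le_eqVlt; apply/orP; left; apply/eqP.
  apply: eq_mean => v _; rewrite (bigD1 i)//= eqxx; congr (_ * _).
  by apply: eq_bigr => k /negbTE ->.
have bgi : bm (fun v => g i (tnth v i)) by exact: bm_mb.
have [_ [MW WM]] := bW; have [_ [Mg gM]] := bgi.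
(* With e = t / c, the error |MW| e on the left side and the error 2 |Mg| e + e^2 under the root are
   both at most [t]; the summand t + 1 secures e <= 1. *)
pose c := t + `|MW| + 2 * `|Mg| + 1.
have c1 : t + 1 <= c by rewrite /c; have := normr_ge0 MW; have := normr_ge0 Mg; lra.
have c0 : 0 < c by lra.
pose e := t / c; have e0 : 0 < e by rewrite divr_gt0.
have ec : e * c = t by rewrite /e divfK// gt_eqF.
have e1 : e <= 1 by rewrite ler_pdivrMr//; lra.
have [_ /(_ _ (exprn_gt0 2 e0))[p pe]] := L2_approx_bounded hmu i (bg i).
have bp : bm (fun v => p.[tnth v i]) by exact: bm_poly.
pose d v := p.[tnth v i] - g i (tnth v i).
have bd : bm d by exact: bmB.
have bd2 : bm (fun v => d v ^+ 2) by exact: bmX.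
(* Cauchy-Schwarz in the form |d| <= (d^2 / e + e) / 2, using that the mean of d^2 is at most
   e^2. *)
have E1 f M : bm f -> (forall v, D v -> `|f v| <= M) -> E (fun v => f v * d v) <= `|M| * e.
  move=> bf fM; apply: (@le_trans _ _ (E (fun v => `|M| / 2 * (e^-1 * d v ^+ 2 + e)))).
    apply: le_mean; [exact: bmM|apply/bmZ/bmD; [exact: bmZ|exact: bm_cst]|].
    move=> v Dv; apply: le_trans (ler_norm _) _; rewrite normrM -mulrA.
    apply: ler_pM => //; first exact: le_trans (fM v Dv) (ler_norm _).
    rewrite -(ler_pM2l (mulr_gt0 (ltr0n _ 2) e0)).
    have -> : 2 * e * (2^-1 * (e^-1 * d v ^+ 2 + e)) = d v ^+ 2 + e ^+ 2.
      by field; rewrite gt_eqF.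
    rewrite -(@real_normK _ (d v)) ?num_real//.
    by have := sqr_ge0 (e - `|d v|); rewrite sqrrB; lra.
  have bed : bm (fun v => e^-1 * d v ^+ 2) by exact: bmZ.
  have -> : E (fun v => `|M| / 2 * (e^-1 * d v ^+ 2 + e))
      = `|M| / 2 * (e^-1 * E (fun v => d v ^+ 2) + e).
    etransitivity; first exact: (meanZ mu _ (bmD bed (bm_cst N e))).
    congr (_ * _); etransitivity; first exact: (meanD mu bed (bm_cst N e)).
    by rewrite mean_cst//; congr (_ + _); exact: (meanZ mu _ bd2).
  rewrite -mulrA ler_wpM2l// ler_pdivrMl//.
  have : e^-1 * E (fun v => d v ^+ 2) <= e by rewrite ler_pdivrMl// -expr2.
  lra.
have X1 : E (fun v => \prod_(k < N) g k (tnth v k)) =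
    E (fun v => p.[tnth v i] * W v) + E (fun v => - W v * d v).
  rewrite -meanD; [|exact: bmM|by apply: bmM => //; exact: bmN].
  by apply: eq_mean => v _; rewrite (bigD1 i)//= /d /W; ring.
have X2 : E (fun v => p.[tnth v i] ^+ 2) <= E (fun v => g i (tnth v i) ^+ 2) + t.
  rewrite (@eq_mean _ _ _ _ (fun v => g i (tnth v i) ^+ 2
      + (2 * (g i (tnth v i) * d v) + d v ^+ 2))); last by move=> v _; rewrite /d; ring.
  have bgd : bm (fun v => g i (tnth v i) * d v) by exact: bmM.
  have bgd2 := bmZ 2 bgd; 
  have -> : E (fun v => g i (tnth v i) ^+ 2 + (2 * (g i (tnth v i) * d v) + d v ^+ 2))
      = E (fun v => g i (tnth v i) ^+ 2)
      + (2 * E (fun v => g i (tnth v i) * d v) + E (fun v => d v ^+ 2)).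
    etransitivity; first exact: (meanD mu (bmX 2 bgi) (bmD bgd2 bd2)).
    congr (_ + _); etransitivity; first exact: (meanD mu bgd2 bd2).
    by congr (_ + _); exact: (meanZ mu 2 bgd).
  have := E1 _ _ bgi gM; have MW0 := normr_ge0 MW.
  have : e ^+ 2 <= e by rewrite expr2 ler_piMr// ltW.
  by rewrite lerD2l; move: ec pe; rewrite -/(d _) /c; nra.
have X3 : E (fun v => - W v * d v) <= t.
  apply: le_trans (E1 _ MW (bmN bW) _) _; first by move=> v /WM; rewrite normrN.
  by move: ec; rewrite /c; have := normr_ge0 Mg; nra.
rewrite X1; apply: lerD X3; apply: le_trans (yp p) _; rewrite (bigD1 i)//=.
apply: ler_pM; rewrite ?sqrtr_ge0//; first exact: ler_wsqrtr.
by apply: ler_prod => k _; rewrite sqrtr_ge0/= ler_wsqrtr// lerDl ltW.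
Qed.

(** Factors are freed one index at a time: the induction is on [n], where only the factors of index
    below [n] may fail to be polynomials. *)
Theorem young_bounded g : (forall k, mb (g k)) -> young_for g.
Proof.
have H n : (n <= N)%N -> forall g, (forall k, mb (g k)) ->
    (forall k : 'I_N, (n <= k)%N -> exists p, g k = horner p) -> young_for g.
  elim: n => [_|n IH nN] {}g bg gp.
    have /choice[p gE] := fun k => gp k (leq0n _).
    have -> : g = fun k => horner (p k) by apply/funext.
    exact: young_poly.
  pose i := Ordinal nN.
  apply: (young_upd (i := i)) => // q; apply: IH; first exact: ltnW.
    by move=> k; rewrite /upd; case: ifP => // _; exact: mb_poly.
  move=> k nk; rewrite /upd; case: eqVneq => [_|ki]; first by exists q.
  apply: gp; rewrite ltn_neqAle nk andbT; apply: contra ki => /eqP nk'.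
  by apply/eqP/val_inj.
move=> bg; apply: (H N) => // k; by rewrite leqNgt ltn_ord.
Qed.

End YoungBounded.

(** * The entropy inequality *)

Section EntropyBound.
Variables (R : realType) (N : nat) (mu : probability (N.-tuple R) R).
Hypotheses (hmu : uniform_on_sphere mu) (N2 : (2 <= N)%N).
Implicit Types (v : N.-tuple R) (F : N.-tuple R -> R) (h : R -> R).
Local Notation D := (@sphere R N).
Local Notation E := (mean mu).

Let mD : measurable D. Proof. exact: measurable_sphere. Qed.

(** Comparing positive and negative parts separately allows infinite integrals, such as an infinite
    entropy. *)
Lemma le_integral_measurable (f g : N.-tuple R -> \bar R) :
  measurable_fun D f -> measurable_fun D g -> (forall v, D v -> (f v <= g v)%E) ->
  (\int[mu]_(v in D) f v <= \int[mu]_(v in D) g v)%E.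
Proof.
move=> mf mg fg; rewrite [leLHS]integralE [leRHS]integralE.
have fgD : {in D, forall v, (f v <= g v)%E} by move=> v; rewrite inE; exact: fg.
apply: leeB; apply: ge0_le_integral => //; try exact: measurable_funepos;
  try exact: measurable_funeneg.
- by move=> v Dv; apply: (funepos_le fgD); rewrite inE.
- by move=> v Dv; apply: (funeneg_le fgD); rewrite inE.
Qed.

Definition intm F := mu.-integrable D (EFin \o F).

Lemma intm_bm F : bm F -> intm F. Proof. exact: bm_integrable. Qed.

Lemma intmM F b : bm b -> intm F -> intm (fun v => b v * F v).
Proof.
move=> [mb [M bM]] iF; apply: (integrableMr mD mb) iF.
exists M; split; first exact: num_real.
by move=> x Mx v Dv; apply: le_trans (bM v Dv) (ltW Mx).
Qed.

Lemma intmZ a F : intm F -> intm (fun v => a * F v).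
Proof. by apply: intmM; exact: bm_cst. Qed.

Lemma intmD F G : intm F -> intm G -> intm (fun v => F v + G v).
Proof. by move=> iF iG; exact: (integrableD mD iF iG). Qed.

Lemma intm_sum (I : Type) (r : seq I) (F : I -> N.-tuple R -> R) :
  (forall i, intm (F i)) -> intm (fun v => \sum_(i <- r) F i v).
Proof.
move=> iF; elim: r => [|i r IH].
  by under eq_fun do rewrite big_nil; exact/intm_bm/bm_cst.
by under eq_fun do rewrite big_cons; exact: intmD.
Qed.

Lemma meanD_int F G : intm F -> intm G -> E (fun v => F v + G v) = E F + E G.
Proof. by move=> iF iG; exact: RintegralD. Qed.

Lemma meanZ_int a F : intm F -> E (fun v => a * F v) = a * E F.
Proof. by move=> iF; exact: RintegralZl. Qed.

Lemma mean_sum_int (I : Type) (r : seq I) (F : I -> N.-tuple R -> R) :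
  (forall i, intm (F i)) ->
  E (fun v => \sum_(i <- r) F i v) = \sum_(i <- r) E (F i).
Proof.
move=> iF; elim: r => [|i r IH].
  by rewrite big_nil -[RHS](mean_cst hmu 0); apply: eq_mean => v _; rewrite big_nil.
rewrite big_cons -IH -meanD_int//; last exact: intm_sum.
by apply: eq_mean => v _; rewrite big_cons.
Qed.

Lemma EFin_mean_int F : intm F -> (E F)%:E = (\int[mu]_(v in D) (F v)%:E)%E.
Proof. by move=> iF; rewrite /mean /Rintegral fineK//; exact: integrable_fin_num iF. Qed.

(** [F] may have infinite integral, so additivity for integrable functions does not apply. Its
    negative part is bounded, and moving it across leaves only nonnegative integrands. *)
Lemma integralD1 F : measurable_fun D F -> (forall v, D v -> -1 <= F v) ->
  (\int[mu]_(v in D) (F v + 1)%:E = \int[mu]_(v in D) (F v)%:E + 1)%E.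
Proof.
move=> mF F1.
pose Fn v := Num.max (- F v) 0; pose Fp v := Num.max (F v) 0.
have mFp : measurable_fun D Fp by apply: measurable_maxr => //; exact: measurable_cst.
have mFn : measurable_fun D Fn.
  by apply: measurable_maxr; [exact: measurable_funN|exact: measurable_cst].
have bFn : bm Fn.
  split => //; exists 1 => v Dv; rewrite ger0_norm ?le_max ?lexx ?orbT//.
  by rewrite ge_max ler01 andbT; have := F1 v Dv; lra.
rewrite [in RHS]integralE.
have -> : (\int[mu]_(v in D) ((fun v => (F v)%:E)^\- v) = (E Fn)%:E)%E.
  by rewrite EFin_mean//; apply: eq_integral => v _; rewrite funenegE -EFinN -EFin_max.
have -> : (\int[mu]_(v in D) ((fun v => (F v)%:E)^\+ v) = \int[mu]_(v in D) (Fp v)%:E)%E.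
  by apply: eq_integral => v _; rewrite funeposE -EFin_max.
have H : (\int[mu]_(v in D) (F v + 1)%:E + (E Fn)%:E = \int[mu]_(v in D) (Fp v)%:E + 1)%E.
  have -> : (1 = \int[mu]_(v in D) (cst 1 v)%:E :> \bar R)%E.
    by rewrite -EFin_mean; [rewrite mean_cst|exact: bm_cst].
  rewrite EFin_mean// -!ge0_integralD//.
  - apply: eq_integral => v _; rewrite -!EFinD /Fn /Fp /=; congr (_%:E).
    by case: (leP (F v) 0) => F0; [rewrite max_l|rewrite max_r]; lra.
  - by move=> v Dv; rewrite lee_fin le_max lexx orbT.
  - exact/measurable_EFinP.
  - exact/measurable_EFinP/measurable_cst.
  - by move=> v Dv; rewrite lee_fin; have := F1 v Dv; lra.
  - by apply/measurable_EFinP; apply: measurable_funD => //; exact: measurable_cst.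
  - by move=> v Dv; rewrite lee_fin le_max lexx orbT.
  - exact/measurable_EFinP.
by rewrite addeAC -H addeK.
Qed.

(** The convex function x ln x lies above its tangent at y; this is the pointwise Gibbs
    inequality. *)
Lemma xlnx_tangent (x y : R) : 0 <= x -> 0 < y -> x * ln y + x - y <= x * ln x.
Proof.
rewrite le_eqVlt => /predU1P[<- y0|x0 y0]; first by rewrite !mul0r; lra.
have yx : 0 < y / x by exact: divr_gt0.
have := @le_ln1Dx _ (y / x - 1) ltac:(lra).
rewrite addrCA subrr addr0 ln_div ?posrE// => H.
have := ler_wpM2l (ltW x0) H; rewrite mulrBr mulrBr mulrCA mulfV ?gt_eqF//; lra.
Qed.

Lemma mb_lin h (a b : R) : mb h -> mb (fun t => a * h t + b).
Proof.
move=> [mh [M hM]]; split.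
  by apply: measurable_funD => //; exact: measurable_funM.
exists (`|a| * M + `|b|) => t /hM ht; apply: le_trans (ler_normD _ _) _.
by rewrite lerD2r normrM ler_wpM2l.
Qed.

Section Clip.
Variables (f : R -> R) (c : R).
Hypotheses (mf : measurable_fun `[(-1 : R), 1] f) (c1 : 1 <= c) (f0 : forall t, 0 <= f t).

(** The ceiling and the floor together make [ln (clip t)] bounded, hence a legitimate test function
    for the marginal. *)
Definition clip t := Num.max (Num.min (f t) c) c^-1.

Let c0 : 0 < c. Proof. exact: lt_le_trans c1. Qed.

Lemma clip_ge t : c^-1 <= clip t. Proof. by rewrite /clip le_max lexx orbT. Qed.

Lemma clip_gt0 t : 0 < clip t.
Proof. by apply: lt_le_trans (clip_ge t); rewrite invr_gt0. Qed.

Lemma clip_le t : clip t <= c.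
Proof.
rewrite /clip ge_max ge_min lexx orbT/=.
by apply: le_trans c1; rewrite invf_le1.
Qed.

Lemma clip_leD t : clip t <= f t + c^-1.
Proof.
have ci : 0 < c^-1 by rewrite invr_gt0.
rewrite /clip ge_max lerDr f0 andbT ge_min; apply/orP; left.
by rewrite lerDl ltW.
Qed.

Lemma mb_clip : mb clip.
Proof.
split; last by exists c => t _; rewrite ger0_norm ?clip_le// ltW// clip_gt0.
apply: measurable_maxr; last exact: measurable_cst.
by apply: measurable_minr => //; exact: measurable_cst.
Qed.

Lemma mb_ln_clip : mb (fun t => ln (clip t)).
Proof.
split; first by apply: measurableT_comp => //; exact: mb_clip.1.
exists (ln c) => t _; rewrite ler_norml -lnV// !ler_ln ?posrE ?invr_gt0 ?clip_gt0//.
by rewrite clip_ge clip_le.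
Qed.

(** The floor only raises the logarithm. Dropping it leaves a truncation monotone in [c], as
    monotone convergence will require. *)
Lemma ln_clip_ge t : f t * ln (Num.min (f t) c) <= f t * ln (clip t).
Proof.
have := f0 t; rewrite le_eqVlt => /predU1P[<-|ft]; first by rewrite !mul0r.
rewrite ler_pM2l// ler_ln ?posrE ?clip_gt0 ?lt_min ?ft//.
by rewrite /clip le_max lexx.
Qed.

End Clip.
End EntropyBound.

(** * Duality and removal of the truncation *)

Section EntropyUpper.
Variables (R : realType) (N : nat) (mu : probability (N.-tuple R) R).
Hypotheses (hmu : uniform_on_sphere mu) (N2 : (2 <= N)%N).
Implicit Types (v : N.-tuple R) (F : N.-tuple R -> R).
Local Notation D := (@sphere R N).
Local Notation E := (mean mu).

Let mD : measurable D. Proof. exact: measurable_sphere. Qed.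

Lemma measurable_comp_coord (h : R -> R) i : measurable_fun `[(-1 : R), 1] h ->
  measurable_fun D (fun v => h (tnth v i)).
Proof.
move=> mh; apply: (@measurable_comp _ _ _ _ _ _ `[(-1 : R), 1]) => //.
  by move=> _ [v /(@sphere_coord _ _ _ i) vi <-]; rewrite /= in_itv/= -ler_norml.
exact: measurable_coord.
Qed.

Lemma prob_density_int F : prob_density mu F -> intm mu F /\ E F = 1.
Proof.
move=> [mF F0 F1]; split; last by rewrite /mean /Rintegral F1.
apply/integrableP; split; first exact/measurable_EFinP.
rewrite (_ : (\int[mu]_(v in D) _)%E = 1%E) ?ltry// -F1.
by apply: eq_integral => v; rewrite inE => Dv; rewrite /= ger0_norm// F0.
Qed.

Lemma marginal_mean F j f (phi : R -> R) : marginal mu F j f -> mb phi ->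
  E (fun v => phi (tnth v j) * F v) = E (fun v => phi (tnth v j) * f (tnth v j)).
Proof.
by move=> [_ _ fE] [mphi [M phiM]]; rewrite /mean /Rintegral fE//; exists M.
Qed.

(** A version of the marginal may be negative on a null set. Testing with the indicator [neg] of
    that set gives a mean that is nonnegative on the side of [F] and nonpositive on the side of [f],
    hence zero. *)
Lemma marginal_pos F j f : prob_density mu F -> marginal mu F j f ->
  marginal mu F j (fun t => Num.max (f t) 0).
Proof.
move=> pF mf; have [iF EF] := prob_density_int pF.
have [mF F0 _] := pF; have [mbf intf fE] := mf.
have mpos : measurable_fun `[(-1 : R), 1] (fun t => Num.max (f t) 0).
  by apply: measurable_maxr => //; exact: measurable_cst.
pose neg : R -> R := \1_(`[(-1 : R), 1] `&` f @^-1` `]-oo, 0[).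
have mbneg : mb neg.
  split; last by exists 1 => t _; rewrite /neg indicE; case: (_ \in _); rewrite ?normr1 ?normr0.
  apply: measurable_indic; apply: mbf => //; exact: measurable_itv.
have negE v : D v -> neg (tnth v j) = (f (tnth v j) < 0)%R%:R.
  move=> Dv; rewrite /neg indicE; congr (_%:R); congr nat_of_bool.
  have := sphere_coord j Dv; rewrite ler_norml => vj.
  apply/idP/idP => [|f0]; first by rewrite inE /= !in_itv/= => -[].
  by rewrite inE /= !in_itv/=; split.
have ineg : intm mu (fun v => neg (tnth v j) * f (tnth v j)).
  by apply: intmM => //; exact: bm_mb.
have Eneg : E (fun v => neg (tnth v j) * f (tnth v j)) = 0.
  apply/eqP; rewrite eq_le; apply/andP; split.
    rewrite -oppr_ge0 -mulN1r -meanZ_int//; apply: mean_ge0 => v Dv.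
    by rewrite negE//; case: ltP => f0; [rewrite mul1r; lra|rewrite mul0r mulr0].
  rewrite -(marginal_mean mf mbneg); apply: mean_ge0 => v Dv.
  by rewrite negE// mulr_ge0// F0.
have posE v : D v -> Num.max (f (tnth v j)) 0
    = f (tnth v j) + - 1 * (neg (tnth v j) * f (tnth v j)).
  move=> Dv; rewrite negE//; case: ltP => f0; first by rewrite mul1r mulN1r subrr.
  by rewrite mul0r mulr0 addr0.
have ipos : intm mu (fun v => Num.max (f (tnth v j)) 0).
  have : intm mu (fun v => f (tnth v j) + - 1 * (neg (tnth v j) * f (tnth v j))).
    by apply: intmD => //; exact: intmZ.
  by apply: eq_integrable => // v; rewrite inE => Dv; rewrite /= posE.
split => // phi mphi phiM; rewrite fE//.
have bphi : bm (fun v => phi (tnth v j)) by exact: bm_comp.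
have ipf : intm mu (fun v => phi (tnth v j) * f (tnth v j)) by exact: intmM.
have ipn : intm mu (fun v => phi (tnth v j) * (neg (tnth v j) * f (tnth v j))) by exact: intmM.
have [M phiM'] := phiM.
have Z : E (fun v => phi (tnth v j) * (neg (tnth v j) * f (tnth v j))) = 0.
  apply/eqP; rewrite -normr_le0; apply: le_trans (le_normr_Rintegral mD ipn) _.
  apply: (@le_trans _ _ (- M * E (fun v => neg (tnth v j) * f (tnth v j)))).
    2: by rewrite Eneg mulr0.
  rewrite -meanZ_int//; apply: le_Rintegral => //.
  - exact: (integrable_norm ipn).
  - exact: (intmZ (- M) ineg).
  move=> v Dv; rewrite normrM mulNr -mulrN; apply: ler_pM => //.
    by apply: phiM'; have := sphere_coord j Dv; rewrite ler_norml.
  rewrite negE//; case: ltP => f0; last by rewrite mul0r normr0 oppr0.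
  by rewrite mul1r ltr0_norm.
rewrite -!EFin_mean_int//; last by apply: intmM.
congr (_%:E).
rewrite [RHS](@eq_mean _ _ _ _ (fun v => phi (tnth v j) * f (tnth v j)
   + - 1 * (phi (tnth v j) * (neg (tnth v j) * f (tnth v j))))); last first.
  by move=> v Dv; rewrite posE//; ring.
by rewrite meanD_int ?meanZ_int ?Z ?mulr0 ?addr0//; exact: intmZ.
Qed.

(** [ln] takes the value 0 at nonpositive arguments, so the integrand vanishes wherever the two
    functions differ. *)
Lemma entropy_pos (f : R -> R) (j : 'I_N) :
  entropy mu (fun v => f (tnth v j)) = entropy mu (fun v => Num.max (f (tnth v j)) 0).
Proof.
apply: eq_integral => v _; congr (_%:E).
by case: (leP (f (tnth v j)) 0) => f0 //; rewrite !ln0// !mulr0.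
Qed.

(* Duality: the Gibbs inequality against the density proportional to the product
   of the square roots of the truncated marginals, whose mass is controlled by
   [young_bounded]. *)
Lemma dual_bound F (f : 'I_N -> R -> R) (c : R) : 1 <= c -> prob_density mu F ->
  (forall j, marginal mu F j (f j)) -> (forall j t, 0 <= f j t) ->
  (\int[mu]_(v in D) (\sum_(j < N)
      (f j (tnth v j) * ln (Num.min (f j (tnth v j)) c) + 1))%:E
    <= 2%:E * entropy mu F + (N%:R * c^-1 + N%:R)%:E)%E.
Proof.
move=> c1 pF mf f0; have [iF EF] := prob_density_int pF; have [mF F0 _] := pF.
have c0 : 0 < c := lt_le_trans ltr01 c1.
have mff j : measurable_fun `[(-1 : R), 1] (f j) by have [] := mf j.
have intf j : intm mu (fun v => f j (tnth v j)) by have [] := mf j.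
pose u j := clip (f j) c.
have mbu j : mb (u j) by apply: mb_clip.
have mbl j : mb (fun t => ln (u j t)) by apply: mb_ln_clip.
pose m j := E (fun v => u j (tnth v j)).
have Ef j : E (fun v => f j (tnth v j)) = 1.
  have m1 : mb (fun=> 1 : R) by split; [exact: measurable_cst|exists `|1|].
  have := marginal_mean (mf j) m1.
  rewrite (@eq_mean _ _ _ (fun v => 1 * F v) F); last by move=> v _; rewrite mul1r.
  rewrite EF => ->; apply: eq_mean => v _; by rewrite mul1r.
have m0 j : 0 < m j.
  apply: (@lt_le_trans _ _ c^-1); first by rewrite invr_gt0.
  rewrite -(mean_cst hmu c^-1); apply: le_mean; [exact: bm_cst|exact: bm_mb|].
  by move=> v _; exact: clip_ge.
have m1 j : m j <= 1 + c^-1.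
  rewrite -(Ef j) -(mean_cst hmu c^-1) -meanD_int//; last exact/intm_bm/bm_cst.
  apply: le_Rintegral => //.
  - exact/intm_bm/bm_mb.
  - by apply: intmD => //; exact/intm_bm/bm_cst.
  by move=> v _; exact: clip_leD.
(* The exponential of [phi j] is the square root of u_j / m_j, whose square has mean 1; every factor
   on the right of the Young inequality is therefore 1. *)
pose phi j t := 2^-1 * ln (u j t) + - (2^-1 * ln (m j)).
have mbphi j : mb (phi j) by exact: mb_lin.
have mbg j : mb (fun t => expR (phi j t)).
  have [mp [M pM]] := mbphi j; split; first exact: measurableT_comp.
  exists (expR M) => t /pM pt; rewrite ger0_norm ?expR_ge0// ler_expR.
  by apply: le_trans pt; exact: ler_norm.
pose L v := \sum_(j < N) phi j (tnth v j).
have bL : bm L by apply: bm_sum => j _; exact: bm_mb.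
have bG : bm (fun v => expR (L v)).
  under eq_fun do rewrite /L expR_sum.
  by apply: bm_prod => j _; exact: (bm_mb j (mbg j)).
have EG : E (fun v => expR (L v)) <= 1.
  have := young_bounded hmu N2 mbg; rewrite /young_for.
  under [X in X <= _ -> _]eq_mean do rewrite -expR_sum.
  move=> /le_trans; apply; rewrite big1// => j _.
  rewrite (@eq_mean _ _ _ _ (fun v => (m j)^-1 * u j (tnth v j))).
    by rewrite meanZ; [rewrite mulVf ?sqrtr1// gt_eqF|exact: bm_mb].
  move=> v _; rewrite -expRM_natl /phi.
  have -> : 2%:R * (2^-1 * ln (u j (tnth v j)) + - (2^-1 * ln (m j)))
    = ln (u j (tnth v j)) - ln (m j) by field.
  by rewrite expRD expRN !lnK ?posrE// ?clip_gt0// mulrC.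
have ent : ((\sum_(j < N) E (fun v => phi j (tnth v j) * F v))%:E <= entropy mu F)%E.
  pose H v := \sum_(j < N) phi j (tnth v j) * F v + (F v + - expR (L v)).
  have iphi j : intm mu (fun v => phi j (tnth v j) * F v) by apply: intmM => //; exact: bm_mb.
  have iG : intm mu (fun v => - expR (L v)) by apply/intm_bm/bmN.
  have iH : intm mu H by apply: intmD; [exact: intm_sum|exact: intmD].
  apply: (@le_trans _ _ (E H)%:E).
    rewrite lee_fin /H meanD_int//; [|exact: intm_sum|exact: intmD].
    rewrite mean_sum_int// lerDl meanD_int// EF meanN; last exact: bG.
    by rewrite subr_ge0.
  rewrite EFin_mean_int//; apply: le_integral_measurable.
  - by have [] := integrableP _ _ _ iH.
  - by apply/measurable_EFinP; apply: measurable_funM => //; exact: measurableT_comp.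
  move=> v Dv; rewrite lee_fin /H -mulr_suml -/(L v) mulrC addrA.
  by have := xlnx_tangent (F0 v Dv) (expR_gt0 (L v)); rewrite expRK.
have ifl j : intm mu (fun v => ln (u j (tnth v j)) * f j (tnth v j)).
  by apply: intmM => //; exact: bm_mb (mbl j).
have phiE j : E (fun v => phi j (tnth v j) * F v)
    = 2^-1 * E (fun v => ln (u j (tnth v j)) * f j (tnth v j)) - 2^-1 * ln (m j).
  rewrite (marginal_mean (mf j) (mbphi j)).
  rewrite (@eq_mean _ _ _ _ (fun v => 2^-1 * (ln (u j (tnth v j)) * f j (tnth v j))
    + - (2^-1 * ln (m j)) * f j (tnth v j))); last by move=> v _; rewrite /phi; ring.
  by rewrite meanD_int ?meanZ_int ?Ef ?mulr1//; exact: intmZ.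
pose K v := \sum_(j < N) (ln (u j (tnth v j)) * f j (tnth v j) + 1).
have iK : intm mu K.
  by apply: intm_sum => j; apply: intmD => //; exact/intm_bm/bm_cst.
apply: (@le_trans _ _ (E K)%:E).
  rewrite EFin_mean_int//; apply: le_integral_measurable.
  - apply/measurable_EFinP; apply: measurable_sum => j.
    apply: measurable_funD; last exact: measurable_cst.
    have mfj : measurable_fun D (fun v => f j (tnth v j)) by exact: measurable_comp_coord.
    apply: measurable_funM => //; apply: measurableT_comp => //.
    by apply: measurable_minr => //; exact: measurable_cst.
  - by have [] := integrableP _ _ _ iK.
  move=> v Dv; rewrite lee_fin; apply: ler_sum => j _; rewrite lerD2r mulrC.
  by rewrite [leRHS]mulrC mulrC; exact: ln_clip_ge.
rewrite /K (mean_sum_int hmu); last by move=> j; apply: intmD => //; exact/intm_bm/bm_cst.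
have KE j : E (fun v => ln (u j (tnth v j)) * f j (tnth v j) + 1)
    = 2 * E (fun v => phi j (tnth v j) * F v) + (ln (m j) + 1).
  rewrite meanD_int//; last exact/intm_bm/bm_cst.
  by rewrite mean_cst// phiE; field.
under eq_bigr do rewrite KE.
rewrite big_split/= -mulr_sumr EFinD EFinM; apply: leeD.
  by apply: lee_wpmul2l.
rewrite lee_fin; have -> : N%:R * c^-1 + N%:R = \sum_(j < N) (c^-1 + 1) :> R.
  by rewrite sumr_const card_ord -[RHS]mulr_natl; ring.
apply: ler_sum => j _; rewrite lerD2r.
(* The floor raises the mass [m j] to at most 1 + 1/c, and ln (1 + x) <= x then gives the error 1/c
   per coordinate. *)
apply: (@le_trans _ _ (ln (1 + c^-1))).
  by rewrite ler_ln ?posrE// addr_gt0// invr_gt0.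
apply: le_ln1Dx; apply: (@lt_le_trans _ _ 0); first by rewrite oppr_lt0.
by rewrite invr_ge0 ltW.
Qed.

Theorem entropy_bound2 : entropy_bound mu 2.
Proof.
move=> F f0 pF mf0.
pose f j t := Num.max (f0 j t) 0.
have mf j : marginal mu F j (f j) by exact: marginal_pos.
have fge j t : 0 <= f j t by rewrite /f le_max lexx orbT.
under eq_bigr do rewrite entropy_pos.
have [->|nS] := eqVneq (entropy mu F) +oo%E.
  by rewrite mulry gtr0_sg// mul1e leey.
pose h j c t := f j t * ln (Num.min (f j t) c).
have mff j : measurable_fun D (fun v => f j (tnth v j)).
  by apply: measurable_comp_coord; have [] := mf j.
have mh j c : measurable_fun D (fun v => h j c (tnth v j)).
  apply: measurable_funM => //; apply: measurableT_comp => //.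
  by apply: measurable_minr => //; exact: measurable_cst.
have mlim j : measurable_fun D (fun v => f j (tnth v j) * ln (f j (tnth v j))).
  by apply: measurable_funM => //; exact: measurableT_comp.
have xlnx1 (x : R) : 0 <= x -> -1 <= x * ln x.
  by move=> x0; apply: le_trans (xlnx_tangent x0 ltr01); rewrite ln1; lra.
have h1 j (n : nat) t : -1 <= h j n.+1%:R t.
  rewrite /h; case: (leP (f j t) n.+1%:R) => fn; first by exact: xlnx1.
  apply: (@le_trans _ _ 0); first by [].
  by rewrite mulr_ge0// ln_ge0// ler1n.
have hnd j t (m n : nat) : (m <= n)%N -> h j m.+1%:R t <= h j n.+1%:R t.
  move=> mn; have := fge j t; rewrite le_eqVlt /h => /predU1P[<-|ft].
    by rewrite !mul0r.
  have n0 (i : nat) : (0 : R) < i.+1%:R by rewrite ltr0n.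
  rewrite ler_pM2l// ler_ln ?posrE ?lt_min ?ft ?n0//.
  by rewrite le_min ge_min lexx/= ge_min ler_nat ltnS mn orbT.
(* Adding 1 per coordinate makes the integrands nonnegative, for monotone convergence; the total N
   is subtracted at the end. Starting the truncation at level 1 is what gives the lower bound -1 in
   [h1]. *)
pose H n v := (\sum_(j < N) (h j n.+1%:R (tnth v j) + 1))%:E.
pose Hl v := (\sum_(j < N) (f j (tnth v j) * ln (f j (tnth v j)) + 1))%:E.
have HlE : (\int[mu]_(v in D) Hl v = \sum_(j < N) entropy mu (fun v => f j (tnth v j))
    + N%:R%:E)%E.
  rewrite /Hl; under eq_integral do rewrite -sumEFin.
  rewrite ge0_integral_sum//; last 2 first.
  - move=> j; apply/measurable_EFinP.
    by apply: measurable_funD => //; exact: measurable_cst.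
  - by move=> j v Dv; rewrite lee_fin; have := xlnx1 _ (fge j (tnth v j)); lra.
  under eq_bigr => j _.
    rewrite integralD1//; last by move=> v Dv; exact: xlnx1.
    over.
  rewrite big_split/=; congr (_ + _)%E.
  by rewrite sumEFin sumr_const card_ord.
have cvgH v : D v -> H n v @[n --> \oo] --> Hl v.
  move=> Dv; apply: cvg_near_cst.
  pose B := \sum_(j < N) f j (tnth v j).
  have B0 : 0 <= B by apply: sumr_ge0.
  exists (Num.bound B) => // n /= Bn; congr (_%:E); apply: eq_bigr => j _.
  rewrite /h min_l//.
  have fB : f j (tnth v j) <= B by rewrite /B (bigD1 j)//= lerDl sumr_ge0.
  apply: le_trans fB _; apply: le_trans (ltW (archi_boundP B0)) _.
  by rewrite ler_nat; lia.
have intH : (\int[mu]_(v in D) H n v)%E @[n --> \oo] --> (\int[mu]_(v in D) Hl v)%E.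
  rewrite (_ : (\int[mu]_(v in D) Hl v)%E
     = (\int[mu]_(v in D) (fun x => limn (H^~ x)) v)%E); last first.
    by apply: eq_integral => v; rewrite inE => /cvgH/cvg_lim ->.
  apply: cvg_monotone_convergence => //.
  - move=> n; apply/measurable_EFinP; apply: measurable_sum => j.
    by apply: measurable_funD => //; exact: measurable_cst.
  - by move=> n v Dv; rewrite lee_fin sumr_ge0// => j _; have := h1 j n (tnth v j); lra.
  - move=> v Dv m n mn; rewrite lee_fin; apply: ler_sum => j _.
    by rewrite lerD2r; exact: hnd.
have Sfin : entropy mu F \is a fin_num.
  rewrite fin_numElt ltey nS andbT (@lt_le_trans _ _ (-1)%:E) ?ltNyr//.
  have [mF F0 _] := pF.
  rewrite -(mean_cst hmu (-1)) EFin_mean; last exact: bm_cst.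
  apply: le_integral_measurable.
  - exact/measurable_EFinP/measurable_cst.
  - by apply/measurable_EFinP; apply: measurable_funM => //; exact: measurableT_comp.
  - by move=> v Dv; rewrite lee_fin; exact/xlnx1/F0.
have Hle : (\int[mu]_(v in D) Hl v <= 2%:E * entropy mu F + N%:R%:E)%E.
  apply/lee_addgt0Pr => e e0.
  apply: (cvge_to_le intH).
  near=> n.
  apply: le_trans (dual_bound (_ : 1 <= n.+1%:R) pF mf fge) _; first by rewrite ler1n.
  rewrite -addeA; apply: leeD => //; rewrite -EFinD lee_fin addrC lerD2l.
  rewrite ler_pdivrMr ?ltr0n// mulrC -ler_pdivrMr//.
  apply: (@le_trans _ _ (Num.bound (N%:R / e))%:R).
    by rewrite ltW// archi_boundP// divr_ge0// ltW.
  rewrite ler_nat; apply: leqW; near: n; exact: nbhs_infty_ge.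
by move: Hle; rewrite HlE leeD2rE.
Unshelve. all: by end_near. Qed.

End EntropyUpper.

(** * Optimality of the constant *)

Section Sharpness.
Variables (R : realType) (N : nat) (mu : probability (N.-tuple R) R).
Hypotheses (hmu : uniform_on_sphere mu) (N2 : (2 <= N)%N).
Implicit Types (v : N.-tuple R).
Local Notation D := (@sphere R N).
Local Notation E := (mean mu).

(** The vanishing mean of the Laplacian of a power of the coordinate is a recursion between moments,
    which stands in for Beta integrals. [slab_rec] does the same with powers of 1 - X^2. *)
Lemma moment_rec (o : 'I_N) n :
  (2 * n + N)%:R * E (fun v => tnth v o ^+ (2 * n.+1))
    = (2 * n + 1)%:R * E (fun v => tnth v o ^+ (2 * n)).
Proof.
have := mean_laplace hmu ('X^((2 * n).+2)) o.
have bx m : bm (fun v => tnth v o ^+ m) by exact/bmX/bm_coord.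
rewrite (@eq_mean _ _ _ _ (fun v => (2 * n.+1)%:R *
   ((2 * n + 1)%:R * tnth v o ^+ (2 * n) + - (2 * n + N)%:R * tnth v o ^+ (2 * n.+1)))).
  rewrite meanZ; last by apply: bmD; exact: bmZ.
  rewrite meanD ?meanZ//; try exact: bmZ.
  move=> /eqP; rewrite mulf_eq0 pnatr_eq0/= => /eqP; lra.
move=> v _; rewrite laplaceXSS// hornerD hornerN !hornerZ !hornerXn.
have -> : (2 * n.+1)%N = (2 * n).+2 by lia.
by rewrite 2!natrM !natrD -!natr1; ring.
Qed.

Lemma slab_rec (j : 'I_N) n :
  (2 * n + N)%:R * E (fun v => (1 - tnth v j ^+ 2) ^+ n.+1)
    = (2 * n + N - 1)%:R * E (fun v => (1 - tnth v j ^+ 2) ^+ n).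
Proof.
have := mean_laplace hmu ((1 - 'X^2) ^+ n.+1) j.
have by_ m : bm (fun v => (1 - tnth v j ^+ 2) ^+ m).
  by apply: bmX; apply: bmB; [exact: bm_cst|exact/bmX/bm_coord].
rewrite (@eq_mean _ _ _ _ (fun v => (2 * n.+1)%:R *
   ((2 * n + N - 1)%:R * (1 - tnth v j ^+ 2) ^+ n
    + - (2 * n + N)%:R * (1 - tnth v j ^+ 2) ^+ n.+1))).
  rewrite meanZ; last by apply: bmD; exact: bmZ.
  rewrite meanD ?meanZ//; try exact: bmZ.
  move=> /eqP; rewrite mulf_eq0 pnatr_eq0/= => /eqP; lra.
move=> v _; rewrite horner_laplace.
have d1 m : ((1 - 'X^2) ^+ m.+1 : {poly R})^`() = - (2 * m.+1)%:R *: ('X * (1 - 'X^2) ^+ m).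
  rewrite deriv_exp /= derivB derivXn -polyC1 derivC sub0r expr1 -mulNrn.
  by rewrite mulrnAl -mulrnA mulNr mulNrn -scaler_nat scaleNr.
(* The factor 1 - x^2 restores the exponent lost in differentiating, so the formula also covers
   [m = 0]. *)
have d0 m x : (1 - x ^+ 2) * ((1 - 'X^2) ^+ m : {poly R})^`().[x]
    = - (2 * m)%:R * (x * (1 - x ^+ 2) ^+ m).
  case: m => [|m]; first by rewrite expr0 -polyC1 derivC horner0 muln0 mulr0 oppr0 mul0r.
  rewrite d1 hornerZ hornerM hornerX horner_exp hornerD hornerN hornerXn -polyC1 hornerC.
  by rewrite [_ ^+ m.+1]exprS; move: (_ ^+ m) => w; ring.
rewrite d1 derivZ derivM derivX mul1r !hornerZ hornerD hornerM hornerX horner_exp.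
rewrite hornerM hornerX horner_exp hornerD hornerN hornerXn -polyC1 hornerC polyC1.
set x := tnth v j; set q := (_^`()).[x].
have := d0 n x; rewrite -/q => dn.
transitivity (- (2 * n.+1)%:R * ((1 - x ^+ 2) * (1 - x ^+ 2) ^+ n + x * ((1 - x ^+ 2) * q))
   + N.-1%:R * (2 * n.+1)%:R * (x ^+ 2 * (1 - x ^+ 2) ^+ n)).
  by move: (_ ^+ n) => w; ring.
have -> : N.-1%:R = N%:R - 1 :> R by rewrite -subn1 natrB// ltnW.
rewrite dn -addnBA ?(ltnW N2)// !(natrM, natrD) natrB ?(ltnW N2)// -natr1.
by rewrite [_ ^+ n.+1]exprS; move: (_ ^+ n) => w; ring.
Qed.


Lemma slab_ge0 (j : 'I_N) v : D v -> 0 <= 1 - tnth v j ^+ 2.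
Proof. by move=> /(@sphere_coord _ _ _ j); rewrite ler_norml; nra. Qed.

Lemma bm_slab (j : 'I_N) n : bm (fun v => (1 - tnth v j ^+ 2) ^+ n).
Proof. by apply: bmX; apply: bmB; [exact: bm_cst|exact/bmX/bm_coord]. Qed.

(** Rotations in the planes (o, k) with k different from j fix v_j, so [mean_rotd2] applies with a
    weight depending on v_j. This is [moment_rec] on the slice at fixed v_j, a sphere of squared
    radius 1 - v_j^2 and one dimension less. *)
Lemma mixed_moment_rec (o j : 'I_N) (phi : R -> R) q m : j != o -> mb phi ->
  (2 * m + N - 1)%:R * E (fun v => phi (tnth v j) * (1 - tnth v j ^+ 2) ^+ q
                                  * tnth v o ^+ (2 * m.+1))
    = (2 * m + 1)%:R * E (fun v => phi (tnth v j) * (1 - tnth v j ^+ 2) ^+ q.+1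
                                  * tnth v o ^+ (2 * m)).
Proof.
move=> jo mphi.
pose W q v := phi (tnth v j) * (1 - tnth v j ^+ 2) ^+ q.
have bW r : bm (W r) by apply: bmM; [exact: bm_mb|exact: bm_slab].
pose p : {poly R} := 'X^((2 * m).+2).
have rot k : k != o -> k != j -> E (fun v => W q v * rotd2 p (tnth v o) (tnth v k)) = 0.
  move=> ko kj; apply: mean_rotd2 => //; first by rewrite eq_sym.
  move=> c s v cs Dv; rewrite /W tnth_rot.
  by rewrite (negbTE jo) eq_sym (negbTE kj).
have sumrot : E (fun v => \sum_(k < N | (k != o) && (k != j))
    W q v * rotd2 p (tnth v o) (tnth v k)) = 0.
  rewrite mean_sum//; last by move=> k _; apply: bmM => //; exact: bm_rotd2.
  by rewrite big1// => k /andP[ko kj]; exact: rot.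
have bx i : bm (fun v => tnth v o ^+ i) by exact/bmX/bm_coord.
have b1 : bm (fun v => W q.+1 v * tnth v o ^+ (2 * m)) by exact: bmM.
have b2 : bm (fun v => W q v * tnth v o ^+ (2 * m.+1)) by exact: bmM.
move: sumrot; rewrite (@eq_mean _ _ _ _ (fun v => (2 * m.+1)%:R *
   ((2 * m + 1)%:R * (W q.+1 v * tnth v o ^+ (2 * m))
    + - (2 * m + N - 1)%:R * (W q v * tnth v o ^+ (2 * m.+1))))).
  rewrite meanZ; last by apply: bmD; exact: bmZ.
  rewrite (meanD mu (bmZ _ b1) (bmZ _ b2)) (meanZ mu _ b1) (meanZ mu _ b2).
  move=> /eqP; rewrite mulf_eq0 pnatr_eq0/= mulNr subr_eq0 => /eqP H.
  exact/esym.
move=> v Dv; rewrite -mulr_sumr /W.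
have cnt : \sum_(k < N | (k != o) && (k != j)) (1 : R) = N%:R - 2.
  have : \sum_(k < N) (1 : R) = 1 + (1 + \sum_(k < N | (k != o) && (k != j)) 1).
    by rewrite [LHS](bigD1 o)//= [in LHS](bigD1 j).
  rewrite sumr_const card_ord; lra.
have sq : \sum_(k < N | (k != o) && (k != j)) tnth v k ^+ 2
    = 1 - tnth v j ^+ 2 - tnth v o ^+ 2.
  have := Dv; rewrite /sphere/= (bigD1 o)//= (bigD1 j)//=; lra.
have -> : \sum_(k < N | (k != o) && (k != j)) rotd2 p (tnth v o) (tnth v k)
    = (1 - tnth v j ^+ 2 - tnth v o ^+ 2) * p^`()^`().[tnth v o]
      - (N%:R - 2) * (tnth v o * p^`().[tnth v o]).
  rewrite sumrB -sq mulr_suml; congr (_ - _).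
  by rewrite -cnt mulr_suml; apply: eq_bigr => k _; rewrite mul1r.
rewrite /p derivXn derivMn derivXn /= !hornerMn !hornerXn.
have -> : (2 * m.+1)%N = (2 * m).+2 by lia.
rewrite -mulrnA -[_ *+ (_ * _)]mulr_natl -[_ *+ _.+2]mulr_natl.
have -> : (2 * m + N - 1)%:R = 2 * m%:R + N%:R - 1 :> R.
  by rewrite natrB; [rewrite natrD natrM|lia].
rewrite natrM natrD -!natr1 natrM.
rewrite [_ ^+ q.+1]exprS [_ ^+ (2 * m).+2]exprS [_ ^+ (2 * m).+1]exprS.
move: (_ ^+ q) (_ ^+ (2 * m)) => A B; ring.
Qed.

(** Since [kappa] is independent of [phi], this identifies the conditional expectation of v_o^(2n)
    given v_j. The induction needs a general power [q], because each step trades v_o^2 for a factor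
    1 - v_j^2. *)
Lemma mixed_moment (o j : 'I_N) n : j != o -> exists kappa : R, forall phi, mb phi ->
  E (fun v => phi (tnth v j) * tnth v o ^+ (2 * n))
    = kappa * E (fun v => phi (tnth v j) * (1 - tnth v j ^+ 2) ^+ n).
Proof.
move=> jo.
suff [kappa K] : exists kappa : R, forall q phi, mb phi ->
    E (fun v => phi (tnth v j) * (1 - tnth v j ^+ 2) ^+ q * tnth v o ^+ (2 * n))
      = kappa * E (fun v => phi (tnth v j) * (1 - tnth v j ^+ 2) ^+ (q + n)).
  exists kappa => phi mphi; have := K 0%N phi mphi; rewrite add0n => <-.
  by apply: eq_mean => v _; rewrite expr0 mulr1.
elim: n => [|n [kappa K]].
  exists 1 => q phi mphi; rewrite addn0 mul1r.
  by apply: eq_mean => v _; rewrite muln0 expr0 mulr1.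
exists ((2 * n + N - 1)%:R^-1 * (2 * n + 1)%:R * kappa) => q phi mphi.
have n0 : (2 * n + N - 1)%:R != 0 :> R by rewrite pnatr_eq0; lia.
apply: (mulfI n0); rewrite mixed_moment_rec// K// (_ : (q + n.+1 = q.+1 + n)%N); last by lia.
by rewrite !mulrA mulfV// mul1r.
Qed.

(** With s = 2n + N - 1 the recursion multiplies b by s / (s + 1), and s (s + 2) <= (s + 1)^2 makes
    b^2 s nonincreasing. Thus b decays at least like n^(-1/2). *)
Lemma slab_moment_bounds (j : 'I_N) n : let b := E (fun v => (1 - tnth v j ^+ 2) ^+ n) in
  0 < b /\ b ^+ 2 * (2 * n + N - 1)%:R <= (N - 1)%:R.
Proof.
move=> b; rewrite {}/b.
have N1 : (1 : R) <= (N - 1)%:R by rewrite ler1n; lia.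
elim: n => [|n [b0 IH]].
  rewrite (@eq_mean _ _ _ _ (fun=> 1)); last by move=> v _; rewrite expr0.
  by rewrite mean_cst// expr1n mul1r muln0 add0n.
have := slab_rec j n; move: b0 IH.
move: (E _) (E _) => b' b b0 IH H.
have e1 : (2 * n + N)%:R = (2 * n + N - 1)%:R + 1 :> R by rewrite natr1; congr (_%:R); lia.
have e2 : (2 * n.+1 + N - 1)%:R = (2 * n + N - 1)%:R + 2 :> R.
  by rewrite -natrD; congr (_%:R); lia.
rewrite e2; rewrite e1 in H.
have s1 : (1 : R) <= (2 * n + N - 1)%:R by rewrite ler1n; lia.
move: (2 * n + N - 1)%:R (N - 1)%:R H IH s1 N1 {e1 e2} => s t H IH s1 N1.
have bE : b' = s * b / (s + 1) by rewrite -H mulrAC mulfV ?mul1r// gt_eqF//; lra.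
split; first by rewrite bE !mulr_gt0 ?invr_gt0//; lra.
have s2 : 0 < (s + 1) ^+ 2 by rewrite exprn_gt0//; lra.
rewrite bE expr_div_n mulrAC ler_pdivrMr// exprMn.
have : s * (s + 2) <= (s + 1) ^+ 2 by nra.
have sb : 0 <= b ^+ 2 * s by rewrite mulr_ge0 ?sqr_ge0//; lra.
move=> /(ler_wpM2l sb) h; have := ler_wpM2r (ltW s2) IH; lra.
Qed.

(** One induction step of [cap_moment_bounds], with m = N - 1. Bernoulli bounds (1 + my)^2 by (1 +
    y)^(2m), which reduces the claim to 4x (x - 1) <= (2x - 1)^2. *)
Lemma cap_growth (x : R) m : 1 < x ->
  (2 * x - 1 + m%:R) ^+ 2 * (x - 1) ^+ m <= (2 * x - 1) ^+ 2 * x ^+ m.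
Proof.
move=> x1; pose y := (2 * x - 1)^-1.
have x2 : 0 < 2 * x - 1 by lra.
have y0 : 0 < y by rewrite invr_gt0.
have yx : (2 * x - 1) * y = 1 by rewrite mulfV// gt_eqF.
have -> : 2 * x - 1 + m%:R = (2 * x - 1) * (1 + m%:R * y).
  by rewrite mulrDr mulr1 mulrCA yx mulr1.
rewrite exprMn -mulrA ler_wpM2l ?sqr_ge0//.
apply: (@le_trans _ _ (((1 + y) ^+ 2 * (x - 1)) ^+ m)).
  rewrite exprMn exprAC ler_wpM2r ?exprn_ge0//; first lra.
  have my : 0 <= m%:R * y by rewrite mulr_ge0// ltW.
  rewrite lerXn2r ?nnegrE ?exprn_ge0//; [lra|lra|].
  by apply: bernoulli_ineq; lra.
have yE : 1 + y = 2 * x * y by move: yx; rewrite mulrBl mul1r; move: y {y0} => y; lra.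
rewrite lerXn2r ?nnegrE; [|by rewrite mulr_ge0 ?sqr_ge0//; lra|lra|].
  by [].
have : (1 + y) ^+ 2 * (x - 1) * (2 * x - 1) ^+ 2 <= x * (2 * x - 1) ^+ 2.
  have -> : (1 + y) ^+ 2 * (x - 1) * (2 * x - 1) ^+ 2
      = 4 * x ^+ 2 * (x - 1) * ((2 * x - 1) * y) ^+ 2 by rewrite yE; ring.
  by rewrite yx expr1n; nra.
by rewrite ler_pM2r// exprn_gt0.
Qed.

(** The product is nondecreasing in n and starts at 1, since the second moment of a coordinate is
    1/N. Hence the moment decays no faster than n^(-(N-1)/2). *)
Lemma cap_moment_bounds (o : 'I_N) n : let c := E (fun v => tnth v o ^+ (2 * n.+1)) in
  0 < c /\ 1 <= c ^+ 2 * n.+1%:R ^+ N.-1 * N%:R ^+ 2.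
Proof.
move=> c; rewrite {}/c; have N0 : (0 : R) < N%:R by rewrite ltr0n; lia.
elim: n => [|n [c0 IH]].
  have := moment_rec o 0.
  rewrite [X in _ = _ * X](@eq_mean _ _ _ _ (fun=> 1)); last first.
    by move=> v _; rewrite muln0 expr0.
  rewrite mean_cst// muln0 !add0n mulr1; move: (E _) => c cN.
  split; first by rewrite -(pmulr_rgt0 _ N0) cN.
  by rewrite expr1n mulr1 -exprMn mulrC cN expr1n.
have := moment_rec o n.+1; have G := @cap_growth n.+2%:R N.-1.
have {}G := G ltac:(by rewrite ltr1n).
have e1 : 2 * n.+2%:R - 1 + N.-1%:R = (2 * n.+1 + N)%:R :> R.
  have -> : (2 * n.+1 + N = (2 * n.+1 + 1) + N.-1)%N by lia.
  by rewrite !natrD natrM -!natr1; ring.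
have e2 : 2 * n.+2%:R - 1 = (2 * n.+1 + 1)%:R :> R by rewrite natrD natrM -!natr1; ring.
have e3 : n.+2%:R - 1 = n.+1%:R :> R by rewrite -[n.+2%:R]natr1; ring.
move: G; rewrite e1 e2 e3; move: c0 IH; move: (E _) (E _) => c' c c0 IH G H.
have s0 : (0 : R) < (2 * n.+1 + N)%:R by rewrite ltr0n; lia.
have t0 : (0 : R) < (2 * n.+1 + 1)%:R by rewrite ltr0n; lia.
have c'0 : 0 < c' by rewrite -(pmulr_rgt0 _ s0) H mulr_gt0.
split => //; apply: le_trans IH _; rewrite ler_wpM2r ?sqr_ge0//.
move: (_%:R ^+ N.-1) (_%:R ^+ N.-1) G => A B G.
have s2 : (0 : R) < (2 * n.+1 + N)%:R ^+ 2 by rewrite exprn_gt0.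
rewrite -(ler_pM2l s2) [leRHS]mulrA -exprMn H exprMn.
rewrite mulrCA -mulrA [leRHS]mulrAC mulrC; have := ler_wpM2l (sqr_ge0 c) G.
lra.
Qed.
End Sharpness.

(** * Entropies of the test densities *)

Section TestDensity.
Variables (R : realType) (N : nat) (mu : probability (N.-tuple R) R).
Hypotheses (hmu : uniform_on_sphere mu) (N2 : (2 <= N)%N).
Implicit Types (v : N.-tuple R).
Local Notation D := (@sphere R N).
Local Notation E := (mean mu).

Let mD : measurable D. Proof. exact: measurable_sphere. Qed.

Variable q : nat.
Let n := q.+2.
Variable o : 'I_N.

Definition cap_mass := E (fun v => tnth v o ^+ (2 * n)).
Definition slab_mass j := E (fun v => (1 - tnth v j ^+ 2) ^+ n).
Definition cap_density v := cap_mass^-1 * tnth v o ^+ (2 * n).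
Definition cap_marginal j (t : R) : R :=
  if j == o then cap_mass^-1 * t ^+ (2 * n) else (slab_mass j)^-1 * (1 - t ^+ 2) ^+ n.

Lemma cap_mass_gt0 : 0 < cap_mass.
Proof. by have [] := cap_moment_bounds hmu N2 o q.+1. Qed.

Lemma slab_mass_gt0 j : 0 < slab_mass j.
Proof. by have [] := slab_moment_bounds hmu N2 j n. Qed.

Lemma bm_cap_density : bm cap_density.
Proof. by apply: bmZ; exact/bmX/bm_coord. Qed.

Lemma cap_density_ge0 v : 0 <= cap_density v.
Proof. by rewrite mulr_ge0 ?invr_ge0 ?(ltW cap_mass_gt0)// exprM exprn_ge0// sqr_ge0. Qed.

Lemma mean_cap_density : E cap_density = 1.
Proof.
rewrite meanZ; last exact/bmX/bm_coord.
by rewrite mulVf// gt_eqF// cap_mass_gt0.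
Qed.

Lemma prob_cap_density : prob_density mu cap_density.
Proof.
split; [exact: bm_cap_density.1|by move=> v _; exact: cap_density_ge0|].
by rewrite -EFin_mean ?mean_cap_density//; exact: bm_cap_density.
Qed.

Lemma bm_cap_marginal j : bm (fun v => cap_marginal j (tnth v j)).
Proof.
rewrite /cap_marginal; case: eqP => _; apply: bmZ; first exact/bmX/bm_coord.
exact: bm_slab.
Qed.

Lemma marginal_cap j : marginal mu cap_density j (cap_marginal j).
Proof.
have bcm := bm_cap_marginal j.
have mcm : measurable_fun `[(-1 : R), 1] (cap_marginal j).
  rewrite /cap_marginal; case: eqP => _; apply: measurable_funM => //;
    apply: measurable_funX => //.
  by apply: measurable_funB => //; exact: measurable_funX.
split => //; first exact: (bm_integrable mu bcm).
move=> phi mphi phiM; have mbphi : mb phi by [].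
have bphi : bm (fun v => phi (tnth v j)) by exact: bm_mb.
rewrite -!EFin_mean//; [|exact: bmM|exact: bmM bm_cap_density].
congr (_%:E).
rewrite [LHS](@eq_mean _ _ _ _ (fun v => cap_mass^-1 * (phi (tnth v j) * tnth v o ^+ (2 * n))));
  last by move=> v _; rewrite /cap_density mulrCA.
rewrite meanZ; last by apply: bmM => //; exact/bmX/bm_coord.
have [jo|jo] := eqVneq j o.
  rewrite -meanZ; last by apply: bmM => //; exact/bmX/bm_coord.
  by apply: eq_mean => v _; rewrite /cap_marginal jo eqxx mulrCA.
rewrite [RHS](@eq_mean _ _ _ _ (fun v => (slab_mass j)^-1 *
  (phi (tnth v j) * (1 - tnth v j ^+ 2) ^+ n))); last first.
  by move=> v _; rewrite /cap_marginal (negbTE jo) mulrCA.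
rewrite [RHS]meanZ; last by apply: bmM => //; exact: bm_slab.
(* Testing with the constant 1 shows that [kappa] is the quotient of the two masses. *)
have [kappa K] := mixed_moment hmu N2 n jo.
have mb1 : mb (fun=> 1 : R) by split; [exact: measurable_cst|exists `|1|].
have := K _ mb1.
rewrite (@eq_mean _ _ _ _ (fun v => tnth v o ^+ (2 * n))); last by move=> v _; rewrite mul1r.
rewrite [X in _ = _ * X](@eq_mean _ _ _ _ (fun v => (1 - tnth v j ^+ 2) ^+ n));
  last by move=> v _; rewrite mul1r.
rewrite -/cap_mass -/(slab_mass j) K// => cE.
have c0 := lt0r_neq0 cap_mass_gt0; have b0 := lt0r_neq0 (slab_mass_gt0 j).
have k0 : kappa != 0 by apply: contraNneq c0 => k0; rewrite cE k0 mul0r.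
by rewrite cE mulrA invfM [kappa^-1 * _]mulrC mulfVK.
Qed.

Let measurable_xlnx (g : N.-tuple R -> R) : measurable_fun D g ->
  measurable_fun D (fun v => (g v * ln (g v))%:E).
Proof.
move=> mg; apply/measurable_EFinP; apply: measurable_funM => //.
exact: measurableT_comp.
Qed.

(** Coordinates are at most 1 in size, so the density is at most 1 / [cap_mass]; the lower bound is
    the tangent of x ln x at 1. *)
Lemma entropy_cap : exists s : R,
  [/\ entropy mu cap_density = s%:E, 0 <= s & s <= - ln cap_mass].
Proof.
have c0 := cap_mass_gt0; have bF := bm_cap_density.
have lo : (0%:E <= entropy mu cap_density)%E.
  have -> : 0 = E (fun v => cap_density v - 1).
    by rewrite meanB ?mean_cap_density ?mean_cst ?subrr//; exact: bm_cst.
  rewrite EFin_mean; last by apply: bmB => //; exact: bm_cst.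
  apply: le_integral_measurable; last first.
  - move=> v _; rewrite lee_fin; apply: le_trans (xlnx_tangent (cap_density_ge0 v) ltr01).
    by rewrite ln1 mulr0 add0r.
  - by apply: measurable_xlnx; exact: bF.1.
  - by apply/measurable_EFinP; apply: measurable_funB; [exact: bF.1|exact: measurable_cst].
have hi : (entropy mu cap_density <= (- ln cap_mass)%:E)%E.
  rewrite -[X in (_ <= X%:E)%E]mulr1 -mean_cap_density -meanZ//.
  rewrite EFin_mean; last exact: bmZ.
  apply: le_integral_measurable.
  - by apply: measurable_xlnx; exact: bF.1.
  - by apply/measurable_EFinP; exact: (bmZ _ bF).1.
  move=> v Dv; rewrite lee_fin [leRHS]mulrC.
  have := cap_density_ge0 v; rewrite le_eqVlt => /predU1P[<-|F0]; first by rewrite !mul0r.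
  rewrite ler_pM2l// -lnV// ler_ln ?posrE ?invr_gt0//.
  rewrite /cap_density ler_piMr ?invr_ge0 ?(ltW c0)// exprM exprn_ile1 ?sqr_ge0//.
  by have := slab_ge0 o Dv; rewrite subr_ge0.
move: lo hi; case: (entropy _ _) => [s| |]; rewrite ?lee_fin ?leye_eq ?leeNy_eq//.
by move=> s0 s1; exists s.
Qed.

(** With y = 1 - v_j^2, the bound ln y >= 1 - 1/y replaces y^n ln y by y^n - y^(n-1), whose mean
    [slab_rec] evaluates. The loss is n / s with s = 2(n - 1) + N - 1 >= n, hence at most 1. *)
Lemma entropy_slab j : j != o ->
  ((- ln (slab_mass j) - 1)%:E <= entropy mu (fun v => cap_marginal j (tnth v j)))%E.
Proof.
move=> jo; have b0 := slab_mass_gt0 j; set b := slab_mass j in b0 *.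
have bS m : bm (fun v => (1 - tnth v j ^+ 2) ^+ m) by exact: bm_slab.
pose h v := n%:R / b * ((1 - tnth v j ^+ 2) ^+ n - (1 - tnth v j ^+ 2) ^+ q.+1)
   + - (ln b / b) * (1 - tnth v j ^+ 2) ^+ n.
have bd : bm (fun v => (1 - tnth v j ^+ 2) ^+ n - (1 - tnth v j ^+ 2) ^+ q.+1) by exact: bmB.
have bh : bm h by apply: bmD; exact: bmZ.
have hE : - ln b - 1 <= E h.
  rewrite /h (meanD mu (bmZ _ bd) (bmZ _ (bS n))) (meanZ mu _ bd) (meanZ mu _ (bS n)).
  rewrite meanB// -/(slab_mass j) -/b.
  have := slab_rec hmu N2 j q.+1; rewrite -/n -/(slab_mass j) -/b.
  move: (E _) => a ab.
  have e1 : (2 * q.+1 + N)%:R = (2 * q.+1 + N - 1)%:R + 1 :> R.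
    by rewrite natr1; congr (_%:R); lia.
  have ns : n%:R <= (2 * q.+1 + N - 1)%:R :> R by rewrite ler_nat /n; lia.
  have n0 : 0 < n%:R :> R by [].
  rewrite e1 in ab; move: (2 * q.+1 + N - 1)%:R n%:R ab ns n0 => s m ab ms m0.
  have s0 : 0 < s := lt_le_trans m0 ms.
  have aE : a = b + b / s by apply: (mulfI (lt0r_neq0 s0)); rewrite -ab; field; rewrite gt_eqF.
  have -> : m / b * (b - a) = - (m / s) by rewrite aE; field; rewrite !gt_eqF.
  have -> : - (ln b / b) * b = - ln b by rewrite mulNr divfK// gt_eqF.
  rewrite [leRHS]addrC lerD2l lerN2.
  by rewrite ler_pdivrMr// mul1r.
apply: (@le_trans _ _ (E h)%:E); first by rewrite lee_fin.
rewrite EFin_mean//; apply: le_integral_measurable.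
- by apply/measurable_EFinP; exact: bh.1.
- by apply: measurable_xlnx; exact: (bm_cap_marginal j).1.
move=> v Dv; rewrite lee_fin /cap_marginal (negbTE jo) -/b /h.
have := slab_ge0 j Dv; rewrite le_eqVlt => /predU1P[<-|y0].
  by rewrite !expr0n/= !(subrr, mulr0, mul0r, addr0).
move: (1 - _) y0 => y y0.
rewrite lnM ?posrE ?invr_gt0 ?exprn_gt0// lnV// lnXn//.
have := @le_ln1Dx _ (y^-1 - 1) ltac:(have : 0 < y^-1 by rewrite invr_gt0; lra).
rewrite addrCA subrr addr0 lnV// => ly.
rewrite /n exprS; set w := y ^+ q.+1.
have w0 : 0 < w by rewrite exprn_gt0.
have -> : q.+2%:R / b * (y * w - w) + - (ln b / b) * (y * w)
   = b^-1 * (y * w) * (- ln b + q.+2%:R * (1 - y^-1)) by field; rewrite !gt_eqF.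
have p0 : 0 < b^-1 * (y * w) by rewrite !mulr_gt0 ?invr_gt0.
rewrite (ler_pM2l p0) lerD2l -[leRHS]mulr_natl ler_wpM2l//.
by lra.
Qed.

(** The test density depends on v_o alone, so its o-th marginal has the full entropy [s]; moving
    that term to the right leaves C - 1. *)
Lemma sharp_ineq (C : R) : entropy_bound mu C -> exists s : R,
  [/\ 0 <= s, s <= (N.-1%:R * ln n%:R + 2 * ln N%:R) / 2 &
      N.-1%:R * ((ln n%:R - ln N%:R) / 2 - 1) <= (C - 1) * s].
Proof.
move=> HC; have [s [sE s0 sc]] := entropy_cap.
have n0 : (0 : R) < n%:R by [].
have N0 : (0 : R) < N%:R by rewrite ltr0n; lia.
exists s; split => //.
  apply: le_trans sc _; have [_] := cap_moment_bounds hmu N2 o q.+1.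
  rewrite -/n -/cap_mass => /ln_ge0; have c0 := cap_mass_gt0.
  rewrite !lnM ?posrE ?mulr_gt0 ?exprn_gt0// !lnXn// -(mulr_natl (ln n%:R)); lra.
have bL j : (ln n%:R - ln N%:R) / 2 - 1 <= - ln (slab_mass j) - 1.
  have [b0 H] := slab_moment_bounds hmu N2 j n; rewrite -/(slab_mass j) in b0 H.
  have : slab_mass j ^+ 2 * n%:R <= N%:R.
    apply: (@le_trans _ _ (slab_mass j ^+ 2 * (2 * n + N - 1)%:R)).
      by rewrite ler_wpM2l ?sqr_ge0// ler_nat; lia.
    by apply: le_trans H _; rewrite ler_nat; lia.
  rewrite -ler_ln ?posrE ?mulr_gt0 ?exprn_gt0// lnM ?posrE ?exprn_gt0// lnXn//.
  by lra.
have := HC _ _ prob_cap_density marginal_cap.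
rewrite sE -EFinM (bigD1 o)//=.
have -> : entropy mu (fun v => cap_marginal o (tnth v o)) = s%:E.
  by rewrite -sE; apply: eq_integral => v _; rewrite /cap_marginal eqxx.
move=> H; have {H} : (s%:E + \sum_(j < N | j != o) ((ln n%:R - ln N%:R) / 2 - 1)%:E
    <= (C * s)%:E)%E.
  apply: le_trans H; apply: leeD => //; apply: lee_sum => j jo.
  by apply: le_trans (entropy_slab jo); rewrite lee_fin.
rewrite sumEFin -EFinD lee_fin sumr_const (cardC1 o) card_ord -[_ *+ _]mulr_natl.
lra.
Qed.

End TestDensity.

Theorem entropy_bound_sharp (R : realType) (N : nat) (mu : probability (N.-tuple R) R)
    (C : R) : uniform_on_sphere mu -> (2 <= N)%N -> entropy_bound mu C -> 2 <= C.
Proof.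
move=> hmu N2 HC; rewrite leNgt; apply/negP => C2.
pose o : 'I_N := Ordinal (ltnW N2).
(* Nonnegativity of [a] lets the upper bound on [s] be used whatever the sign of C - 1. *)
pose a := Num.max (C - 1) 0.
have a0 : 0 <= a by rewrite le_max lexx orbT.
have a1 : a < 1 by rewrite gt_max ltr01 andbT; lra.
have aC : C - 1 <= a by rewrite le_max lexx.
pose M : R := N.-1%:R.
have M0 : 0 < M by rewrite ltr0n; lia.
have lnN : 0 <= ln (N%:R : R) by rewrite ln_ge0// ler1n; lia.
have ln2 : 0 < ln (2 : R) by rewrite ln_gt0// ltr1n.
have : M / 2 * (1 - a) * ln 2 <= 0.
  apply: (@le0_of_bounded_multiples _ _ (a * ln N%:R + M * (ln N%:R / 2 + 1))) => k.
  (* Powers of 2 make ln n linear in k, so comparing growth rates reduces to the Archimedean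
     property. *)
  have [q qk] : exists q, (2 ^ k.+1 = q.+2)%N.
    exists (2 ^ k.+1 - 2)%N; have := expn_gt0 2 k; rewrite expnS; lia.
  have [s [s0 sle]] := sharp_ineq hmu N2 q o HC.
  rewrite -qk natrX lnXn// -(mulr_natl (ln 2)) -/M in sle *.
  set X := k.+1%:R * ln 2 => H.
  have kX : k%:R * ln 2 <= X by rewrite ler_wpM2r ?ler_nat// ltW.
  have Cs : (C - 1) * s <= a * ((M * X + 2 * ln N%:R) / 2).
    by apply: (@le_trans _ _ (a * s)); [rewrite ler_wpM2r|rewrite ler_wpM2l].
  have : M / 2 * (1 - a) * (k%:R * ln 2) <= M / 2 * (1 - a) * X.
    by rewrite ler_wpM2l// mulr_ge0 ?divr_ge0 ?(ltW M0)//; lra.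
  move: (ln 2) X (ln N%:R) kX Cs H => l X y kX Cs H; lra.
by rewrite leNgt !mulr_gt0 ?invr_gt0//; lra.
Qed.

Theorem theorem2 (R : realType) (N : nat) (hN : (2 <= N)%N)
    (mu : probability (N.-tuple R) R) (hmu : uniform_on_sphere mu) :
  entropy_bound mu 2 /\ (forall C : R, entropy_bound mu C -> 2 <= C).
Proof.
split; first exact: entropy_bound2.
by move=> C; exact: entropy_bound_sharp.
Qed.
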